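(* Let $R$ be a commutative ring with unit and $M$ an $R$-module. There exists a bijection $$\Gamma:\mathbf{BrAnn}[R,M]\to H^3_{ab}(R,M),\qquad [\mathcal A]\mapsto q_*^{-1}p^*[(h,\beta)_{\mathcal A}],$$ where $(p,q)$ is the pre-stick of type $(R,M)$ of $\mathcal A$.
   Context: **Ann-categories.** Write $XY=X\otimes Y$. An Ann-category is a category $\mathcal A$ with bifunctors $\oplus,\otimes$ such that: $(\mathcal A,\oplus,a^+,c^+,(0,g,d))$ is a symmetric categorical group (a symmetric monoidal groupoid in which every object is invertible; $a^+_{X,Y,Z}:X\oplus(Y\oplus Z)\to(X\oplus Y)\oplus Z$, $g_X:0\oplus X\to X$, $d_X:X\oplus 0\to X$); $(\mathcal A,\otimes,a,(1,l,r))$ is a monoidal category ($a_{X,Y,Z}:X(YZ)\to(XY)Z$, $l_X:1X\to X$, $r_X:X1\to X$); with natural isomorphisms $\mathfrak L_{A,X,Y}:A(X\oplus Y)\to AX\oplus AY$, $\mathfrak R_{X,Y,A}:(X\oplus Y)A\to XA\oplus YA$ such that for each $A$ the pairs $(A\otimes-,\mathfrak L_{A,-,-})$ and $(-\otimes A,\mathfrak R_{-,-,A})$ are $\oplus$-functors compatible with $a^+,c^+$, and (1) $(a_{A,B,X}\oplus a_{A,B,Y})\mathfrak L_{A,BX,BY}(id_A\otimes\mathfrak L_{B,X,Y})=\mathfrak L_{AB,X,Y}\,a_{A,B,X\oplus Y}$; (2) $\mathfrak R_{XB,YB,A}(\mathfrak R_{X,Y,B}\otimes id_A)a_{X\oplus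 Y,B,A}=(a_{X,B,A}\oplus a_{Y,B,A})\mathfrak R_{X,Y,BA}$; (3) $\mathfrak R_{AX,AY,B}(\mathfrak L_{A,X,Y}\otimes id_B)a_{A,X\oplus Y,B}=(a_{A,X,B}\oplus a_{A,Y,B})\mathfrak L_{A,XB,YB}(id_A\otimes\mathfrak R_{X,Y,B})$; (4) $v(\mathfrak R_{A,B,X}\oplus\mathfrak R_{A,B,Y})\mathfrak L_{A\oplus B,X,Y}=(\mathfrak L_{A,X,Y}\oplus\mathfrak L_{B,X,Y})\mathfrak R_{A,B,X\oplus Y}$, where $v:(U\oplus V)\oplus(Z\oplus T)\to(U\oplus Z)\oplus(V\oplus T)$ is the canonical morphism built from $a^+,c^+,id$; (5) $(l_X\oplus l_Y)\mathfrak L_{1,X,Y}=l_{X\oplus Y}$, $(r_X\oplus r_Y)\mathfrak R_{X,Y,1}=r_{X\oplus Y}$. A braided Ann-category is an Ann-category with a braiding $c_{A,B}:AB\to BA$ making $(\mathcal A,\otimes,a,c,(1,l,r))$ a braided monoidal category (Joyal–Street), with $c_{0,0}=id$ and $\mathfrak R_{X,Y,A}\,c_{A,X\oplus Y}=(c_{A,X}\oplus c_{A,Y})\mathfrak L_{A,X,Y}$. A braided Ann-functor $(F,\breve F,\widetilde F,F_* ):\mathcal A\to\mathcal A'$ consists of a functor $F$ with natural isomorphisms $\breve F_{X,Y}:FX\oplus FY\to F(X\oplus Y)$, $\widetilde F_{X,Y}:FX\otimes FY\to F(X\otimes Y)$ and $F_*:1'\to F1$, such that $(F,\breve F)$ is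 a symmetric monoidal functor for $\oplus$, $(F,\widetilde F,F_* )$ is a braided monoidal functor for $\otimes$, and $F(\mathfrak L_{X,Y,Z})\widetilde F_{X,Y\oplus Z}(id\otimes\breve F_{Y,Z})=\breve F_{XY,XZ}(\widetilde F_{X,Y}\oplus\widetilde F_{X,Z})\mathfrak L'_{FX,FY,FZ}$, $F(\mathfrak R_{X,Y,Z})\widetilde F_{X\oplus Y,Z}(\breve F_{X,Y}\otimes id)=\breve F_{XZ,YZ}(\widetilde F_{X,Z}\oplus\widetilde F_{Y,Z})\mathfrak R'_{FX,FY,FZ}$. **Invariants.** $\pi_0\mathcal A$ is the set of isomorphism classes of objects, a commutative ring under the operations induced by $\oplus,\otimes$. $\pi_1\mathcal A=\mathrm{Aut}(0)$, an abelian group written additively. For each $X$ there is a unique isomorphism $\hat L^X:X0\to 0$ (resp. $\hat R^X:0X\to0$) making $(X\otimes-,\mathfrak L_{X,-,-})$ (resp. $(-\otimes X,\mathfrak R_{-,-,X})$) compatible with the unit constraints of $\oplus$. $\pi_1\mathcal A$ is a $\pi_0\mathcal A$-module: for $X\in s$, $su$ is defined by $\hat L^X(id_X\otimes u)=(su)\hat L^X$. For each $X$, $\gamma_X:\mathrm{Aut}(0)\to\mathrm{Aut}(X)$ is the isomorphism with $\gamma_X(u)g_X=g_X(u\oplus id_X)$. A braided Ann-functor $F$ induces $F_0:\pi_0\mathcal A\to\pi_0\mathcal A'$, $[X]\mapsto[FX]$ and $F_1:\pi_1\mathcal A\to\pi_1\mathcal A'$, $u\mapsto\gamma_{F0}^{-1}(Fu)$.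 **Cohomology.** Let $R$ be a commutative unital ring and $M$ an $R$-module (as a bimodule, $xm=mx$). $Z^3_{MacL}(R,M)$ is the group of $h=(\xi,\eta,\alpha,\lambda,\rho)$, $\xi,\alpha,\lambda,\rho:R^3\to M$, $\eta:R^2\to M$, with, for all $x,y,z,t\in R$: S1. $\xi(y,z,t)-\xi(x+y,z,t)+\xi(x,y+z,t)-\xi(x,y,z+t)+\xi(x,y,z)=0$; S2. $\xi(x,y,z)-\xi(x,z,y)+\xi(z,x,y)+\eta(x+y,z)-\eta(x,z)-\eta(y,z)=0$; S3. $\eta(x,y)+\eta(y,x)=0$; S4. $x\eta(y,z)-\eta(xy,xz)=\lambda(x,y,z)-\lambda(x,z,y)$; S5. $\eta(x,y)z-\eta(xz,yz)=\rho(x,y,z)-\rho(y,x,z)$; S6. $x\xi(y,z,t)-\xi(xy,xz,xt)=\lambda(x,z,t)-\lambda(x,y+z,t)+\lambda(x,y,z+t)-\lambda(x,y,z)$; S7. $\xi(x,y,z)t-\xi(xt,yt,zt)=\rho(y,z,t)-\rho(x+y,z,t)+\rho(x,y+z,t)-\rho(x,y,z)$; S8. $\rho(x,y,z+t)-\rho(x,y,z)-\rho(x,y,t)+\lambda(x,z,t)+\lambda(y,z,t)-\lambda(x+y,z,t)=-\xi(xz+xt,yz,yt)+\xi(xz,xt,yz)-\eta(xt,yz)+\xi(xz+yz,xt,yt)-\xi(xz,yz,xt)$; S9. $\alpha(x,y,z+t)-\alpha(x,y,z)-\alpha(x,y,t)=x\lambda(y,z,t)+\lambda(x,yz,yt)-\lambda(xy,z,t)$;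 S10. $\alpha(x,y+z,t)-\alpha(x,y,t)-\alpha(x,z,t)=x\rho(y,z,t)-\rho(xy,xz,t)+\lambda(x,yt,zt)-\lambda(x,y,z)t$; S11. $\alpha(x+y,z,t)-\alpha(x,z,t)-\alpha(y,z,t)=-\rho(x,y,z)t-\rho(xz,yz,t)+\rho(x,y,zt)$; S12. $x\alpha(y,z,t)-\alpha(xy,z,t)+\alpha(x,yz,t)-\alpha(x,y,zt)+\alpha(x,y,z)t=0$; and normalized: $\xi$ and $\alpha$ vanish when some argument is $0$, $\alpha$ vanishes when some argument is $1$, $\lambda(1,y,z)=\lambda(0,y,z)=\lambda(x,0,z)=\lambda(x,y,0)=0$, $\rho(x,y,1)=\rho(0,y,z)=\rho(x,0,z)=\rho(x,y,0)=0$. For $g=(\mu,\nu)$, $\mu,\nu:R^2\to M$, normalized by $\mu(0,y)=\mu(x,0)=0$, $\nu(0,y)=\nu(x,0)=\nu(1,y)=\nu(x,1)=0$, put $\partial_{MacL}g=(\xi,\eta,\alpha,\lambda,\rho)$ with $\xi(x,y,z)=\mu(y,z)-\mu(x+y,z)+\mu(x,y+z)-\mu(x,y)$, $\eta(x,y)=\mu(x,y)-\mu(y,x)$, $\alpha(x,y,z)=x\nu(y,z)-\nu(xy,z)+\nu(x,yz)-\nu(x,y)z$, $\lambda(x,y,z)=\nu(x,y+z)-\nu(x,y)-\nu(x,z)+x\mu(y,z)-\mu(xy,xz)$, $\rho(x,y,z)=\nu(x+y,z)-\nu(x,z)-\nu(y,z)+\mu(x,y)z-\mu(xz,yz)$.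 $Z^3_{ab}(R,M)$ is the group of pairs $(h,\beta)$, $h\in Z^3_{MacL}(R,M)$, $\beta:R^2\to M$, with S20. $\alpha(x,y,z)-\alpha(x,z,y)+\alpha(z,x,y)-x\beta(y,z)+\beta(xy,z)-y\beta(x,z)=0$; S21. $\alpha(x,y,z)-\alpha(y,x,z)+\alpha(y,z,x)+y\beta(x,z)-\beta(x,yz)+z\beta(x,y)=0$; S22. $\beta(x,y)-\beta(x,y+z)+\beta(x,z)=\rho(y,z,x)-\lambda(x,y,z)$. $B^3_{ab}(R,M)$ is the subgroup of the elements $\partial(\mu,\nu)=(\partial_{MacL}(\mu,\nu),\ \beta(x,y)=\nu(x,y)-\nu(y,x))$, and $H^3_{ab}=Z^3_{ab}/B^3_{ab}$. **The class $[(h,\beta)_{\mathcal A}]$.** A stick in $\mathcal A$ is a choice of representatives $X_s$, $s\in\pi_0\mathcal A$, with $X_0=0,X_1=1$, and isomorphisms $\varphi_{s,t}:X_s\oplus X_t\to X_{s+t}$, $\psi_{s,t}:X_sX_t\to X_{st}$ with $\varphi_{0,t}=g_{X_t}$, $\varphi_{s,0}=d_{X_s}$, $\psi_{1,t}=l_{X_t}$, $\psi_{s,1}=r_{X_s}$, $\psi_{0,t}=\hat R^{X_t}$, $\psi_{s,0}=\hat L^{X_s}$. Let $s\mathcal A$ be the category with objects the elements of $\pi_0\mathcal A$, morphisms only automorphisms $(s,u)$, $u\in\pi_1\mathcal A$, composition addition in $\pi_1\mathcal A$, $(s,u)\oplus(t,v)=(s+t,u+v)$, $(s,u)\otimes(t,v)=(st,sv+tu)$,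 with strict unit constraints. The functor $H:s\mathcal A\to\mathcal A$, $H(s)=X_s$, $H(s,u)=\gamma_{X_s}(u)$, with $\breve H=\varphi$, $\widetilde H=\psi$, $H_*=id_1$, transports the constraints $a^+,c^+,a,\mathfrak L,\mathfrak R,c$ of $\mathcal A$ to constraints of $s\mathcal A$ given by functions $(h,\beta)=(\xi,\eta,\alpha,\lambda,\rho,\beta)\in Z^3_{ab}(\pi_0\mathcal A,\pi_1\mathcal A)$ (the unique ones with which $H$ is compatible; e.g. $\gamma_{X_{rs}}(\beta(r,s))\psi_{r,s}=\psi_{s,r}c_{X_r,X_s}$). $[(h,\beta)_{\mathcal A}]\in H^3_{ab}(\pi_0\mathcal A,\pi_1\mathcal A)$ is its class (independent of the stick). **Pre-sticks.** $\mathcal A$ has a pre-stick of type $(R,M)$ if it is equipped with a pair $\epsilon=(p,q)$ of a ring isomorphism $p:R\to\pi_0\mathcal A$ and a group isomorphism $q:M\to\pi_1\mathcal A$ with $q(su)=p(s)q(u)$ for $s\in R$, $u\in M$. A morphism between braided Ann-categories $\mathcal A,\mathcal A'$ with pre-sticks $(p,q),(p',q')$ of type $(R,M)$ is a braided Ann-functor $F:\mathcal A\to\mathcal A'$ with $F_0p=p'$ and $F_1q=q'$ (such an $F$ is an equivalence). $\mathbf{BrAnn}[R,M]$ is the set of classes of braided Ann-categories with pre-stick of type $(R,M)$, two being in the same class if there is such a morphism between them. $p^*$ denotes precomposition with $p$ and $q_*^{-1}$ postcomposition with $q^{-1}$.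
   Formalization: In S7 the last term is read as ρ(x,y,t) instead of ρ(x,y,z), without which coboundaries need not be cocycles; for R = 0, where a stick with X_0 = 0, X_1 = 1 may not exist, the bijection is claimed but not the existence of the class. *)

(* Defs.v *)
From HB Require Import structures.
From mathcomp Require Import all_boot all_algebra.
From mathcomp Require Import boolp classical_sets functions.

Set Implicit Arguments.
Unset Strict Implicit.
Unset Printing Implicit Defensive.

Import GRing.Theory.
Local Open Scope ring_scope.
Local Open Scope quotient_scope.

Declare Scope cat_scope.
Delimit Scope cat_scope with cat.
Local Open Scope cat_scope.

Reserved Notation "g ∘ f" (at level 40, left associativity).
Reserved Notation "X ⊕ Y" (at level 38, right associativity).
Reserved Notation "X ⊗ Y" (at level 36, right associativity).
Reserved Notation "f ⊞ g" (at level 38, right associativity).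
Reserved Notation "f ⊠ g" (at level 36, right associativity).

(* The category underlying an Ann-category is a groupoid, because (A, ⊕) is a
   categorical group; hence natural transformations below are automatically
   natural isomorphisms. *)
Record groupoid := Groupoid {
  obj :> Type;
  mor : obj -> obj -> Type;
  idm : forall X, mor X X;
  mcomp : forall X Y Z, mor Y Z -> mor X Y -> mor X Z;
  minv : forall X Y, mor X Y -> mor Y X;
  comp1m : forall X Y (f : mor X Y), mcomp (idm Y) f = f;
  compm1 : forall X Y (f : mor X Y), mcomp f (idm X) = f;
  mcompA : forall X Y Z T (h : mor Z T) (g : mor Y Z) (f : mor X Y),
    mcomp h (mcomp g f) = mcomp (mcomp h g) f;
  compVm : forall X Y (f : mor X Y), mcomp (minv f) f = idm X;
  compmV : forall X Y (f : mor X Y), mcomp f (minv f) = idm Y }.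

Notation "g ∘ f" := (mcomp g f) : cat_scope.

Definition eqm (C : groupoid) (X Y : C) (e : X = Y) : mor X Y :=
  match e in _ = Z return mor X Z with erefl => idm X end.

Record monoidal (C : groupoid) := Monoidal {
  tens : C -> C -> C;
  tensm : forall X X' Y Y' : C,
    mor X X' -> mor Y Y' -> mor (tens X Y) (tens X' Y');
  munit : C;
  massoc : forall X Y Z, mor (tens X (tens Y Z)) (tens (tens X Y) Z);
  mlunit : forall X, mor (tens munit X) X;
  mrunit : forall X, mor (tens X munit) X;
  tensm1 : forall X Y, tensm (idm X) (idm Y) = idm (tens X Y);
  tensmM : forall X X' X'' Y Y' Y'' (f' : mor X' X'') (f : mor X X')
      (g' : mor Y' Y'') (g : mor Y Y'),
    tensm (f' ∘ f) (g' ∘ g) = tensm f' g' ∘ tensm f g;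
  massoc_nat : forall X X' Y Y' Z Z' (f : mor X X') (g : mor Y Y')
      (h : mor Z Z'),
    massoc X' Y' Z' ∘ tensm f (tensm g h)
    = tensm (tensm f g) h ∘ massoc X Y Z;
  mlunit_nat : forall X Y (f : mor X Y),
    mlunit Y ∘ tensm (idm munit) f = f ∘ mlunit X;
  mrunit_nat : forall X Y (f : mor X Y),
    mrunit Y ∘ tensm f (idm munit) = f ∘ mrunit X;
  pentagon : forall X Y Z T,
    massoc (tens X Y) Z T ∘ massoc X Y (tens Z T)
    = tensm (massoc X Y Z) (idm T) ∘ massoc X (tens Y Z) T
      ∘ tensm (idm X) (massoc Y Z T);
  triangle : forall X Y,
    tensm (mrunit X) (idm Y) ∘ massoc X munit Y = tensm (idm X) (mlunit Y) }.

Record braiding (C : groupoid) (T : monoidal C) := Braiding {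
  br :> forall X Y, mor (tens T X Y) (tens T Y X);
  br_nat : forall X X' Y Y' (f : mor X X') (g : mor Y Y'),
    br X' Y' ∘ tensm T f g = tensm T g f ∘ br X Y;
  hexagonr : forall X Y Z,
    br X (tens T Y Z)
    = massoc T Y Z X ∘ tensm T (idm Y) (br X Z) ∘ minv (massoc T Y X Z)
      ∘ tensm T (br X Y) (idm Z) ∘ massoc T X Y Z;
  hexagonl : forall X Y Z,
    br (tens T X Y) Z
    = minv (massoc T Z X Y) ∘ tensm T (br X Z) (idm Y) ∘ massoc T X Z Y
      ∘ tensm T (idm X) (br Y Z) ∘ minv (massoc T X Y Z) }.

Record symCatGroup (C : groupoid) := SymCatGroup {
  smon :> monoidal C;
  sbr : braiding smon;
  sbr_sym : forall X Y, sbr Y X ∘ sbr X Y = idm (tens smon X Y);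
  sinvertible : forall X : C,
    exists X' : C, inhabited (mor (tens smon X X') (munit smon)) }.

Record functor (C D : groupoid) := Functor {
  fobj :> C -> D;
  fmap : forall X Y, mor X Y -> mor (fobj X) (fobj Y);
  fmap1 : forall X, fmap (idm X) = idm (fobj X);
  fmapM : forall X Y Z (g : mor Y Z) (f : mor X Y),
    fmap (g ∘ f) = fmap g ∘ fmap f }.

(* Compatibility of (F, phi) with the associativity constraints and with the
   commutativity constraints or braidings. *)
Record ac_functor (C D : groupoid) (T : monoidal C) (c : braiding T)
    (T' : monoidal D) (c' : braiding T') (F : functor C D)
    (phi : forall X Y, mor (tens T' (F X) (F Y)) (F (tens T X Y))) : Prop := {
  ac_nat : forall X X' Y Y' (f : mor X X') (g : mor Y Y'),
    phi X' Y' ∘ tensm T' (fmap F f) (fmap F g)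
    = fmap F (tensm T f g) ∘ phi X Y;
  ac_assoc : forall X Y Z,
    fmap F (massoc T X Y Z) ∘ phi X (tens T Y Z) ∘ tensm T' (idm _) (phi Y Z)
    = phi (tens T X Y) Z ∘ tensm T' (phi X Y) (idm _) ∘ massoc T' _ _ _;
  ac_br : forall X Y, fmap F (c X Y) ∘ phi X Y = phi Y X ∘ c' (F X) (F Y) }.

Record unit_compat (C D : groupoid) (T : monoidal C) (T' : monoidal D)
    (F : functor C D)
    (phi : forall X Y, mor (tens T' (F X) (F Y)) (F (tens T X Y)))
    (e : mor (munit T') (F (munit T))) : Prop := {
  unit_compatl : forall X,
    fmap F (mlunit T X) ∘ phi (munit T) X ∘ tensm T' e (idm _)
    = mlunit T' (F X);
  unit_compatr : forall X,
    fmap F (mrunit T X) ∘ phi X (munit T) ∘ tensm T' (idm _) e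
    = mrunit T' (F X) }.

Section GroupoidTheory.
Variable C : groupoid.

Lemma compKm (X Y Z : C) (f : mor Y Z) (g : mor X Y) : minv f ∘ (f ∘ g) = g.
Proof. by rewrite mcompA compVm comp1m. Qed.

Lemma compVKm (X Y Z : C) (f : mor Y Z) (g : mor X Z) : f ∘ (minv f ∘ g) = g.
Proof. by rewrite mcompA compmV comp1m. Qed.

Lemma compmK (X Y Z : C) (f : mor X Y) (g : mor Y Z) : g ∘ f ∘ minv f = g.
Proof. by rewrite -mcompA compmV compm1. Qed.

Lemma compmVK (X Y Z : C) (f : mor Y X) (g : mor Y Z) : g ∘ minv f ∘ f = g.
Proof. by rewrite -mcompA compVm compm1. Qed.

Lemma compmI (X Y Z : C) (f : mor X Y) (g h : mor Y Z) :
  g ∘ f = h ∘ f -> g = h.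
Proof. by move=> e; rewrite -(compmK f g) e compmK. Qed.

Lemma compIm (X Y Z : C) (f : mor Y Z) (g h : mor X Y) :
  f ∘ g = f ∘ h -> g = h.
Proof. by move=> e; rewrite -(compKm f g) e compKm. Qed.
Arguments compmI [X Y Z] f [g h].
Arguments compIm [X Y Z] f [g h].

Lemma minvK (X Y : C) (f : mor X Y) : minv (minv f) = f.
Proof. by apply: (compmI (minv f)); rewrite compVm compmV. Qed.

Lemma minvM (X Y Z : C) (g : mor Y Z) (f : mor X Y) :
  minv (g ∘ f) = minv f ∘ minv g.
Proof. by apply: (compmI (g ∘ f)); rewrite compVm mcompA compmVK compVm. Qed.

Lemma minv1 (X : C) : minv (idm X) = idm X.
Proof. by rewrite -[LHS]comp1m compmV. Qed.

Variable T : monoidal C.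
Local Notation "X ⊕ Y" := (tens T X Y) : cat_scope.
Local Notation "f ⊞ g" := (tensm T f g) : cat_scope.

Lemma tensmV (X X' Y Y' : C) (f : mor X X') (g : mor Y Y') :
  minv (f ⊞ g) = minv f ⊞ minv g.
Proof.
by apply: (compmI (f ⊞ g)); rewrite compVm -tensmM !compVm tensm1.
Qed.

Lemma tensmlr (X X' Y Y' : C) (f : mor X X') (g : mor Y Y') :
  (f ⊞ idm Y') ∘ (idm X ⊞ g) = f ⊞ g.
Proof. by rewrite -tensmM compm1 comp1m. Qed.

Lemma tensmrl (X X' Y Y' : C) (f : mor X X') (g : mor Y Y') :
  (idm X' ⊞ g) ∘ (f ⊞ idm Y) = f ⊞ g.
Proof. by rewrite -tensmM compm1 comp1m. Qed.

Lemma tens1_inj (X Y : C) (f g : mor X Y) :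
  idm (munit T) ⊞ f = idm (munit T) ⊞ g -> f = g.
Proof.
by move=> e; apply: (compmI (mlunit T X)); rewrite -!mlunit_nat e.
Qed.

Lemma tensr1_inj (X Y : C) (f g : mor X Y) :
  f ⊞ idm (munit T) = g ⊞ idm (munit T) -> f = g.
Proof.
by move=> e; apply: (compmI (mrunit T X)); rewrite -!mrunit_nat e.
Qed.

Lemma mlunit_tens (X Y : C) :
  (mlunit T X ⊞ idm Y) ∘ massoc T (munit T) X Y = mlunit T (X ⊕ Y).
Proof.
apply: tens1_inj; apply: (compIm (massoc T _ _ _)).
rewrite -{1}(comp1m (idm (munit T))) tensmM !mcompA massoc_nat.
rewrite -(triangle T (munit T) X) -{1}(comp1m (idm Y)) tensmM.
rewrite -!mcompA (mcompA (massoc T _ _ _ ⊞ idm Y)) -pentagon.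
rewrite !mcompA -massoc_nat tensm1 -!mcompA; congr (_ ∘ _).
exact: triangle.
Qed.

Lemma mlrunit : mlunit T (munit T) = mrunit T (munit T).
Proof.
apply: tensr1_inj; apply: (compmI (massoc T _ _ _)).
rewrite mlunit_tens triangle.
by apply: (compIm (mlunit T _)); rewrite mlunit_nat.
Qed.

Lemma mlunit_br (c : braiding T) (X : C) :
  mlunit T X ∘ c X (munit T) = mrunit T X.
Proof.
apply: tensr1_inj; set I := munit T.
apply: (compmI (massoc T X I I)); apply: (compIm (c X I)).
rewrite triangle br_nat hexagonr !mcompA mlunit_tens mlunit_nat.
by rewrite -mlunit_tens !mcompA compmK -[X in _ ⊞ X]comp1m tensmM !mcompA.
Qed.

Definition interchangem (c : braiding T) (U V Z W : C) :
    mor ((U ⊕ V) ⊕ (Z ⊕ W)) ((U ⊕ Z) ⊕ (V ⊕ W)) :=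
  minv (massoc T (U ⊕ Z) V W) ∘ (massoc T U Z V ⊞ idm W)
  ∘ ((idm U ⊞ c V Z) ⊞ idm W) ∘ (minv (massoc T U V Z) ⊞ idm W)
  ∘ massoc T (U ⊕ V) Z W.

Lemma massocV_nat (X X' Y Y' Z Z' : C) (f : mor X X') (g : mor Y Y')
    (h : mor Z Z') :
  minv (massoc T X' Y' Z') ∘ ((f ⊞ g) ⊞ h)
  = (f ⊞ (g ⊞ h)) ∘ minv (massoc T X Y Z).
Proof. by apply: (compmI (massoc T X Y Z)); rewrite compmVK -mcompA -massoc_nat compKm. Qed.

Lemma interchange_nat (c : braiding T) (U U' V V' Z Z' W W' : C)
    (f : mor U U') (g : mor V V') (h : mor Z Z') (k : mor W W') :
  interchangem c U' V' Z' W' ∘ ((f ⊞ g) ⊞ (h ⊞ k))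
  = ((f ⊞ h) ⊞ (g ⊞ k)) ∘ interchangem c U V Z W.
Proof.
have E (X Y X' Y' : C) : interchangem c X Y X' Y' =
    minv (massoc T (X ⊕ X') Y Y')
    ∘ ((massoc T X X' Y ∘ (idm X ⊞ c Y X') ∘ minv (massoc T X Y X')) ⊞ idm Y')
    ∘ massoc T (X ⊕ Y) X' Y'.
  by rewrite /interchangem -!(mcompA (minv (massoc T (X ⊕ X') Y Y'))) -!tensmM !comp1m.
rewrite !E -mcompA massoc_nat !mcompA -massocV_nat; congr (_ ∘ _).
rewrite -!(mcompA (minv (massoc T (U' ⊕ Z') V' W'))) -!tensmM comp1m compm1.
rewrite -(mcompA _ _ (_ ⊞ h)) massocV_nat !mcompA -massoc_nat.
by rewrite -!(mcompA (massoc T U' Z' V')) -!tensmM comp1m compm1 br_nat.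
Qed.

End GroupoidTheory.
Arguments compmI [C X Y Z] f [g h].
Arguments compIm [C X Y Z] f [g h].

Section CatGroupTheory.
Variables (C : groupoid) (S : symCatGroup C).
Local Notation "X ⊕ Y" := (tens S X Y) : cat_scope.
Local Notation "f ⊞ g" := (tensm S f g) : cat_scope.
Local Notation O := (munit S).

Lemma tensr_faithful_full (X : C) : exists2 X' : C,
  forall Y Z (f g : mor Y Z), f ⊞ idm X = g ⊞ idm X -> f = g
  & forall Y Z (h : mor (Y ⊕ X) (Z ⊕ X)),
      exists f : mor Y Z, f ⊞ idm X = h.
Proof.
have key (W : C) : exists (W' : C)
    (th : forall Y, mor ((Y ⊕ W) ⊕ W') Y), forall Y Z (f : mor Y Z),
    f ∘ th Y = th Z ∘ ((f ⊞ idm W) ⊞ idm W').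
  have [W' [e]] := sinvertible S W.
  exists W'; exists (fun Y => mrunit S Y ∘ (idm Y ⊞ e) ∘ minv (massoc S Y W W')).
  move=> Y Z f; apply: (compmI (massoc S Y W W')).
  rewrite !mcompA compmVK -!mcompA -massoc_nat tensm1 compKm tensmrl mcompA.
  by rewrite -mrunit_nat -mcompA tensmlr.
have inj (W : C) Y Z (f g : mor Y Z) : f ⊞ idm W = g ⊞ idm W -> f = g.
  have [W' [th nat_th]] := key W.
  by move=> e; apply: (compmI (th Y)); rewrite !nat_th e.
have [X' [th nat_th]] := key X; exists X' => [|Y Z h]; first exact: inj.
exists (th Z ∘ (h ⊞ idm X') ∘ minv (th Y)).
apply: (inj X'); apply: (compIm (th Z)).
by rewrite -nat_th compmVK.
Qed.

Lemma tensr_inj (X Y Z : C) (f g : mor Y Z) :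
  f ⊞ idm X = g ⊞ idm X -> f = g.
Proof. by have [X' + _] := tensr_faithful_full X; apply. Qed.

Lemma tensr_full (X Y Z : C) (h : mor (Y ⊕ X) (Z ⊕ X)) :
  exists f : mor Y Z, f ⊞ idm X = h.
Proof. by have [X' _ +] := tensr_faithful_full X; apply. Qed.

Lemma tens_autE (u v : mor O O) : mlunit S O ∘ (u ⊞ v) = u ∘ v ∘ mlunit S O.
Proof.
by rewrite -tensmlr mcompA [in LHS]mlrunit mrunit_nat -!mcompA -mlrunit mlunit_nat.
Qed.

Lemma aut_comm (u v : mor O O) : u ∘ v = v ∘ u.
Proof.
apply: (compmI (mlunit S O)); rewrite -tens_autE -tensmrl mcompA mlunit_nat.
by rewrite -!mcompA {1}mlrunit mrunit_nat -mlrunit.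
Qed.

Lemma interchange_lunit (Z W : C) :
  (mlunit S Z ⊞ mlunit S W) ∘ interchangem (sbr S) O O Z W
  = mlunit S (Z ⊕ W) ∘ (mlunit S O ⊞ (idm Z ⊞ idm W)).
Proof.
have cl X : mrunit S X ∘ sbr S O X = mlunit S X.
  by rewrite -(mlunit_br (sbr S)) -mcompA sbr_sym compm1.
rewrite /interchangem -[X in X ∘ _]tensmlr !mcompA.
have -> : (mlunit S Z ⊞ idm W) ∘ (idm (O ⊕ Z) ⊞ mlunit S W)
    ∘ minv (massoc S (O ⊕ Z) O W) = (mlunit S Z ∘ mrunit S (O ⊕ Z)) ⊞ idm W.
  by rewrite -triangle !mcompA compmK -tensmM comp1m.
rewrite -!tensmM !comp1m -mrunit_nat -(mcompA (mrunit S Z)) mlunit_tens.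
rewrite -(mcompA (mrunit S Z)) mlunit_nat !mcompA cl.
rewrite -[mlunit S (O ⊕ Z)]mlunit_tens !mcompA compmK.
rewrite -[X in _ ⊞ X]comp1m tensmM -!mcompA -massoc_nat !mcompA mlunit_tens.
by [].
Qed.

End CatGroupTheory.

Section UnitCompat.
Variables (C D : groupoid) (S : symCatGroup C) (S' : symCatGroup D).
Variables (F : functor C D).
Variable phi : forall X Y, mor (tens S' (F X) (F Y)) (F (tens S X Y)).
Hypothesis acF : ac_functor (sbr S) (sbr S') phi.
Local Notation O := (munit S).
Local Notation O' := (munit S').
Local Notation "f ⊞ g" := (tensm S' f g) : cat_scope.

Lemma unit_compat_exists : exists e : mor O' (F O), unit_compat phi e.
Proof.
pose kap Y := fmap F (mlunit S Y) ∘ phi O Y.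
have kapK Y : (kap O ⊞ idm (F Y)) ∘ massoc S' _ _ _ = idm (F O) ⊞ kap Y.
  have natl (f : mor (tens S O O) O) : phi O Y ∘ (fmap F f ⊞ idm (F Y))
      = fmap F (tensm S f (idm Y)) ∘ phi _ Y.
    by rewrite -[idm (F Y)](fmap1 F) (ac_nat acF).
  have natr f : phi O Y ∘ (idm (F O) ⊞ fmap F f)
      = fmap F (tensm S (idm O) f) ∘ phi O (tens S O Y).
    by rewrite -[idm (F O)](fmap1 F) (ac_nat acF).
  have -> : kap O ⊞ idm (F Y)
      = (fmap F (mlunit S O) ⊞ idm _) ∘ (phi O O ⊞ idm _).
    by rewrite -tensmM comp1m.
  have -> : idm (F O) ⊞ kap Y
      = (idm _ ⊞ fmap F (mlunit S Y)) ∘ (idm _ ⊞ phi O Y).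
    by rewrite -tensmM comp1m.
  apply: (compIm (kap Y)).
  rewrite /kap !mcompA -!(mcompA (fmap F (mlunit S Y)) (phi O Y)) natl natr.
  rewrite -!mcompA (mcompA (phi _ _)) -(ac_assoc acF) !mcompA -!fmapM.
  by rewrite -(mcompA _ _ (massoc S _ _ _)) mlrunit triangle.
have [m mE] := tensr_full (minv (mlunit S' (F O)) ∘ kap O).
have kapE Y : kap Y = mlunit S' (F Y) ∘ (m ⊞ idm (F Y)).
  apply: (compmI (idm (F O) ⊞ kap Y)).
  rewrite -[RHS]mcompA tensmlr -(tensmrl S' m) (mcompA (mlunit S' _)) mlunit_nat -[RHS]mcompA.
  congr (_ ∘ _).
  rewrite -kapK -[kap O](compVKm (mlunit S' (F O))) -mE.
  rewrite -[X in _ ⊞ X]comp1m tensmM -mcompA -massoc_nat tensm1 mcompA.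
  by rewrite mlunit_tens.
have lE Y : kap Y ∘ (minv m ⊞ idm (F Y)) = mlunit S' (F Y).
  by rewrite kapE -mcompA -tensmM compmV comp1m tensm1 compm1.
exists (minv m); split=> X; first exact: lE.
rewrite -(mlunit_br (sbr S)) fmapM -(mcompA (fmap F _)) (ac_br acF).
by rewrite -!mcompA br_nat !mcompA -/(kap X) lE mlunit_br.
Qed.

Lemma unit_compat_inj (e e' : mor O' (F O)) (X : C) :
  fmap F (mlunit S X) ∘ phi O X ∘ (e ⊞ idm _) = mlunit S' (F X) ->
  fmap F (mlunit S X) ∘ phi O X ∘ (e' ⊞ idm _) = mlunit S' (F X) ->
  e = e'.
Proof.
by move=> <- /compIm ee'; apply/esym/(@tensr_inj _ S' (F X)).
Qed.

End UnitCompat.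

Section TensorFunctors.
Variables (C : groupoid) (T : monoidal C) (A : C).

Fact ltens_fmap1 (X : C) : tensm T (idm A) (idm X) = idm (tens T A X).
Proof. exact: tensm1. Qed.

Fact ltens_fmapM (X Y Z : C) (g : mor Y Z) (f : mor X Y) :
  tensm T (idm A) (g ∘ f) = tensm T (idm A) g ∘ tensm T (idm A) f.
Proof. by rewrite -tensmM comp1m. Qed.

Definition ltens : functor C C := Functor ltens_fmap1 ltens_fmapM.

Fact rtens_fmap1 (X : C) : tensm T (idm X) (idm A) = idm (tens T X A).
Proof. exact: tensm1. Qed.

Fact rtens_fmapM (X Y Z : C) (g : mor Y Z) (f : mor X Y) :
  tensm T (g ∘ f) (idm A) = tensm T g (idm A) ∘ tensm T f (idm A).
Proof. by rewrite -tensmM comp1m. Qed.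

Definition rtens : functor C C := Functor rtens_fmap1 rtens_fmapM.
End TensorFunctors.

Section Distributivity.
Variables (C : groupoid) (S : symCatGroup C) (T : monoidal C).
Local Notation "X ⊕ Y" := (tens S X Y) : cat_scope.
Local Notation "f ⊞ g" := (tensm S f g) : cat_scope.
Local Notation "X ⊗ Y" := (tens T X Y) : cat_scope.
Local Notation "f ⊠ g" := (tensm T f g) : cat_scope.
Local Notation I := (munit T).
Local Notation a := (massoc T).

(* The structure isomorphism of the ⊕-functor A ⊗ - is the inverse of
   A ⊗ (X ⊕ Y) -> A ⊗ X ⊕ A ⊗ Y, since functors are given with structure
   isomorphisms FX ⊕ FY -> F(X ⊕ Y); likewise for - ⊗ A. *)
Record distributivity := Distributivity {
  Ld : forall A X Y, mor (A ⊗ (X ⊕ Y)) (A ⊗ X ⊕ A ⊗ Y);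
  Rd : forall X Y A, mor ((X ⊕ Y) ⊗ A) (X ⊗ A ⊕ Y ⊗ A);
  Ld_nat : forall A A' X X' Y Y' (f : mor A A') (g : mor X X') (h : mor Y Y'),
    Ld A' X' Y' ∘ (f ⊠ (g ⊞ h)) = (f ⊠ g ⊞ f ⊠ h) ∘ Ld A X Y;
  Rd_nat : forall X X' Y Y' A A' (g : mor X X') (h : mor Y Y') (f : mor A A'),
    Rd X' Y' A' ∘ ((g ⊞ h) ⊠ f) = (g ⊠ f ⊞ h ⊠ f) ∘ Rd X Y A;
  Ld_functor : forall A,
    @ac_functor _ _ _ (sbr S) _ (sbr S) (ltens T A) (fun X Y => minv (Ld A X Y));
  Rd_functor : forall A,
    @ac_functor _ _ _ (sbr S) _ (sbr S) (rtens T A) (fun X Y => minv (Rd X Y A));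
  Ld_assoc : forall A B X Y,
    (a A B X ⊞ a A B Y) ∘ Ld A (B ⊗ X) (B ⊗ Y) ∘ (idm A ⊠ Ld B X Y)
    = Ld (A ⊗ B) X Y ∘ a A B (X ⊕ Y);
  Rd_assoc : forall X Y B A,
    Rd (X ⊗ B) (Y ⊗ B) A ∘ (Rd X Y B ⊠ idm A) ∘ a (X ⊕ Y) B A
    = (a X B A ⊞ a Y B A) ∘ Rd X Y (B ⊗ A);
  LRd_assoc : forall A X Y B,
    Rd (A ⊗ X) (A ⊗ Y) B ∘ (Ld A X Y ⊠ idm B) ∘ a A (X ⊕ Y) B
    = (a A X B ⊞ a A Y B) ∘ Ld A (X ⊗ B) (Y ⊗ B) ∘ (idm A ⊠ Rd X Y B);
  LRd_interchange : forall A B X Y,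
    interchangem (sbr S) _ _ _ _ ∘ (Rd A B X ⊞ Rd A B Y) ∘ Ld (A ⊕ B) X Y
    = (Ld A X Y ⊞ Ld B X Y) ∘ Rd A B (X ⊕ Y);
  Ld_unit : forall X Y,
    (mlunit T X ⊞ mlunit T Y) ∘ Ld I X Y = mlunit T (X ⊕ Y);
  Rd_unit : forall X Y,
    (mrunit T X ⊞ mrunit T Y) ∘ Rd X Y I = mrunit T (X ⊕ Y) }.

End Distributivity.

Record annCat := AnnCat {
  ann_car :> groupoid;
  ann_add : symCatGroup ann_car;
  ann_mul : monoidal ann_car;
  ann_distr : distributivity ann_add ann_mul }.

Record brAnnCat := BrAnnCat {
  brann_car :> annCat;
  brann_br : braiding (ann_mul brann_car);
  brann_br00 : brann_br (munit (ann_add brann_car)) (munit (ann_add brann_car))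
               = idm _;
  brann_distr : forall A X Y : brann_car,
    Rd (ann_distr brann_car) X Y A ∘ brann_br A (tens (ann_add brann_car) X Y)
    = tensm (ann_add brann_car) (brann_br A X) (brann_br A Y)
      ∘ Ld (ann_distr brann_car) A X Y }.

Record brAnnFunctor (A B : brAnnCat) := BrAnnFunctor {
  baf_fun :> functor A B;
  baf_add : forall X Y,
    mor (tens (ann_add B) (baf_fun X) (baf_fun Y)) (baf_fun (tens (ann_add A) X Y));
  baf_mul : forall X Y,
    mor (tens (ann_mul B) (baf_fun X) (baf_fun Y)) (baf_fun (tens (ann_mul A) X Y));
  baf_one : mor (munit (ann_mul B)) (baf_fun (munit (ann_mul A)));
  (* compatibility with the units of ⊕ is automatic: see unit_compat_exists *)
  baf_add_functor : ac_functor (sbr (ann_add A)) (sbr (ann_add B)) baf_add;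
  baf_mul_functor : ac_functor (brann_br A) (brann_br B) baf_mul;
  baf_mul_unit : unit_compat baf_mul baf_one;
  baf_Ld : forall X Y Z,
    fmap baf_fun (Ld (ann_distr A) X Y Z) ∘ baf_mul X (tens (ann_add A) Y Z)
      ∘ tensm (ann_mul B) (idm _) (baf_add Y Z)
    = baf_add _ _ ∘ tensm (ann_add B) (baf_mul X Y) (baf_mul X Z)
      ∘ Ld (ann_distr B) (baf_fun X) (baf_fun Y) (baf_fun Z);
  baf_Rd : forall X Y Z,
    fmap baf_fun (Rd (ann_distr A) X Y Z) ∘ baf_mul (tens (ann_add A) X Y) Z
      ∘ tensm (ann_mul B) (baf_add X Y) (idm _)
    = baf_add _ _ ∘ tensm (ann_add B) (baf_mul X Z) (baf_mul Y Z)
      ∘ Rd (ann_distr B) (baf_fun X) (baf_fun Y) (baf_fun Z) }.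

Section Invariants.
Variable A : brAnnCat.
Local Notation S := (ann_add A).
Local Notation T := (ann_mul A).
Local Notation L := (Ld (ann_distr A)).
Local Notation R := (Rd (ann_distr A)).
Local Notation O := (munit S).
Local Notation I := (munit T).
Local Notation "X ⊕ Y" := (tens S X Y) : cat_scope.
Local Notation "f ⊞ g" := (tensm S f g) : cat_scope.
Local Notation "X ⊗ Y" := (tens T X Y) : cat_scope.
Local Notation "f ⊠ g" := (tensm T f g) : cat_scope.
Local Notation g := (mlunit S).
Local Notation d := (mrunit S).

Definition iso : rel {classic A} := fun X Y => `[< inhabited (mor X Y) >].

Fact iso_is_equiv : equiv_class_of iso.
Proof.
split=> [X|X Y|Y X Z].
- by apply/asboolP; exists; apply: idm.
- by apply/asboolP/asboolP=> -[f]; exists; apply: minv f.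
- by move=> /asboolP[f] /asboolP[h]; apply/asboolP; exists; apply: (h ∘ f).
Qed.
Canonical iso_equiv := EquivRelPack iso_is_equiv.

Definition pi0 := {eq_quot iso}.
HB.instance Definition _ := Choice.on pi0.

Definition cls (X : A) : pi0 := \pi_(pi0) (X : {classic A}).
Definition repr0 (s : pi0) : A := repr s.

Lemma repr0K (s : pi0) : cls (repr0 s) = s.
Proof. exact: reprK. Qed.

Lemma clsP (X Y : A) : cls X = cls Y <-> inhabited (mor X Y).
Proof.
by split=> [/eqP|XY]; [rewrite piE => /asboolP|apply/eqP; rewrite piE; apply/asboolP].
Qed.

Lemma hom_cls (X Y : A) : mor X Y -> cls X = cls Y.
Proof. by move=> f; apply/clsP. Qed.

Definition add0 (s t : pi0) := cls (repr0 s ⊕ repr0 t).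
Definition mul0 (s t : pi0) := cls (repr0 s ⊗ repr0 t).

Definition opp_obj (X : A) : A := projT1 (cid (sinvertible S X)).
Definition opp0 (s : pi0) := cls (opp_obj (repr0 s)).

Lemma cls_add (X Y : A) : cls (X ⊕ Y) = add0 (cls X) (cls Y).
Proof.
have /clsP[f] := esym (repr0K (cls X)); have /clsP[h] := esym (repr0K (cls Y)).
by apply: hom_cls (f ⊞ h).
Qed.

Lemma cls_mul (X Y : A) : cls (X ⊗ Y) = mul0 (cls X) (cls Y).
Proof.
have /clsP[f] := esym (repr0K (cls X)); have /clsP[h] := esym (repr0K (cls Y)).
by apply: hom_cls (f ⊠ h).
Qed.

Fact add0A : associative add0.
Proof.
move=> s t u; rewrite -(repr0K s) -(repr0K t) -(repr0K u) -!cls_add.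
exact: hom_cls (massoc S _ _ _).
Qed.

Fact add0C : commutative add0.
Proof. by move=> s t; apply: hom_cls (sbr S _ _). Qed.

Fact add00 : left_id (cls O) add0.
Proof. by move=> s; rewrite -(repr0K s) -cls_add; apply: hom_cls (g _). Qed.

Fact add0N : left_inverse (cls O) opp0 add0.
Proof.
move=> s; rewrite add0C -{1}(repr0K s) -cls_add /opp_obj.
by case: cid => X' XX'; apply/clsP.
Qed.

HB.instance Definition _ := GRing.isZmodule.Build pi0 add0A add0C add00 add0N.

Fact mul0A : associative mul0.
Proof.
move=> s t u; rewrite -(repr0K s) -(repr0K t) -(repr0K u) -!cls_mul.
exact: hom_cls (massoc T _ _ _).
Qed.

Fact mul0C : commutative mul0.
Proof. by move=> s t; apply: hom_cls (brann_br A _ _). Qed.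

Fact mul01 : left_id (cls I) mul0.
Proof. by move=> s; rewrite -(repr0K s) -cls_mul; apply: hom_cls (mlunit T _). Qed.

Fact mul0D : left_distributive mul0 add0.
Proof.
move=> s t u; rewrite -(repr0K s) -(repr0K t) -(repr0K u).
by rewrite -!(cls_add, cls_mul); apply: hom_cls (R _ _ _).
Qed.

HB.instance Definition _ :=
  GRing.Zmodule_isComPzRing.Build pi0 mul0A mul0C mul01 mul0D.

Lemma cls0 : cls O = 0. Proof. by []. Qed.
Lemma cls1 : cls I = 1. Proof. by []. Qed.
Lemma clsD (X Y : A) : cls (X ⊕ Y) = cls X + cls Y.
Proof. exact: cls_add. Qed.
Lemma clsM (X Y : A) : cls (X ⊗ Y) = cls X * cls Y.
Proof. exact: cls_mul. Qed.

Definition gamma (X : A) (u : mor O O) : mor X X :=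
  g X ∘ (u ⊞ idm X) ∘ minv (g X).

Lemma gammaE (X : A) (u : mor O O) : gamma X u ∘ g X = g X ∘ (u ⊞ idm X).
Proof. by rewrite /gamma compmVK. Qed.

Lemma gamma_surj (X : A) (f : mor X X) : exists u, gamma X u = f.
Proof.
have [u uE] := tensr_full (minv (g X) ∘ f ∘ g X).
by exists u; rewrite /gamma uE !mcompA compmV comp1m compmK.
Qed.

Lemma gamma_inj (X : A) : injective (gamma X).
Proof. by move=> u v /compmI/compIm/tensr_inj. Qed.

Definition gammaV (X : A) (f : mor X X) : mor O O :=
  projT1 (cid (gamma_surj f)).

Lemma gammaVK (X : A) : cancel (@gammaV X) (gamma X).
Proof. by move=> f; rewrite /gammaV; case: cid. Qed.

Lemma gammaK (X : A) : cancel (gamma X) (@gammaV X).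
Proof. by move=> u; apply: (@gamma_inj X); rewrite gammaVK. Qed.

Definition Lhat (X : A) : mor (X ⊗ O) O :=
  minv (projT1 (cid (unit_compat_exists (Ld_functor (ann_distr A) X)))).

Definition Rhat (X : A) : mor (O ⊗ X) O :=
  minv (projT1 (cid (unit_compat_exists (Rd_functor (ann_distr A) X)))).

Lemma Lhat_compat (X : A) :
  @unit_compat _ _ S S (ltens T X) (fun Y Z => minv (L X Y Z)) (minv (Lhat X)).
Proof. by rewrite /Lhat minvK; case: cid. Qed.

Lemma Rhat_compat (X : A) :
  @unit_compat _ _ S S (rtens T X) (fun Y Z => minv (R Y Z X)) (minv (Rhat X)).
Proof. by rewrite /Rhat minvK; case: cid. Qed.

Lemma LhatE (X Y : A) :
  g (X ⊗ Y) ∘ (Lhat X ⊞ idm (X ⊗ Y)) ∘ L X O Y = idm X ⊠ g Y.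
Proof.
have /= := unit_compatl (Lhat_compat X) Y.
rewrite -[_ ⊞ _]minvK tensmV minvK minv1 => <-.
by rewrite compmVK compmVK.
Qed.

Lemma Lhat_eq (X Y : A) (l : mor (X ⊗ O) O) :
  g (X ⊗ Y) ∘ (l ⊞ idm (X ⊗ Y)) ∘ L X O Y = idm X ⊠ g Y -> l = Lhat X.
Proof. by rewrite -LhatE => /compmI/compIm/tensr_inj. Qed.

Lemma RhatE (X Y : A) :
  g (Y ⊗ X) ∘ (Rhat X ⊞ idm (Y ⊗ X)) ∘ R O Y X = g Y ⊠ idm X.
Proof.
have /= := unit_compatl (Rhat_compat X) Y.
rewrite -[_ ⊞ _]minvK tensmV minvK minv1 => <-.
by rewrite compmVK compmVK.
Qed.

Lemma Lhat_nat (X Y : A) (f : mor X Y) : Lhat Y ∘ (f ⊠ idm O) = Lhat X.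
Proof.
apply: (@Lhat_eq X O); apply: (compIm (f ⊠ idm O)).
rewrite tensmlr -(tensmrl T f (g O)) -LhatE !mcompA -mlunit_nat -!mcompA.
congr (_ ∘ _); rewrite -[idm (O ⊕ O)]tensm1 Ld_nat !mcompA; congr (_ ∘ _).
by rewrite -!tensmM !comp1m !compm1.
Qed.

Lemma Lhat_mul (X Y : A) :
  Lhat (X ⊗ Y) ∘ massoc T X Y O = Lhat X ∘ (idm X ⊠ Lhat Y).
Proof.
apply: (compmI (minv (massoc T X Y O))); rewrite compmK; apply/esym.
apply: (@Lhat_eq _ O); apply: (compmI (massoc T X Y (O ⊕ O))).
rewrite -[idm (X ⊗ Y)]tensm1 -massoc_nat -(LhatE Y).
rewrite !ltens_fmapM -(LhatE X) -!(mcompA (g _ ∘ _)) -Ld_assoc.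
rewrite Ld_nat tensm1 !mcompA -mlunit_nat.
congr (_ ∘ _ ∘ _); rewrite -!mcompA.
by rewrite -!tensmM !(comp1m, compm1) !mcompA compmVK.
Qed.

Lemma Lhat_one : Lhat I = mlunit T O.
Proof.
apply/esym/(@Lhat_eq _ O); apply: (compIm (mlunit T O)).
rewrite mlunit_nat -(Ld_unit (ann_distr A)) !mcompA -mlunit_nat; congr (_ ∘ _).
by rewrite -!mcompA -tensmM comp1m compm1.
Qed.

Lemma Lhat_add (X Y : A) :
  Lhat (X ⊕ Y) = g O ∘ (Lhat X ⊞ Lhat Y) ∘ R X Y O.
Proof.
apply/esym/(@Lhat_eq _ O); apply: (compIm (R X Y O)).
rewrite -[idm (X ⊕ Y)]tensm1 Rd_nat -!LhatE !tensmM.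
rewrite -[RHS]mcompA -(LRd_interchange (ann_distr A)).
move: (interchange_nat (sbr S) (Lhat X) (Lhat Y)
  (idm (X ⊗ O)) (idm (Y ⊗ O))) (interchange_lunit S (X ⊗ O) (Y ⊗ O)).
move: (interchangem _ _ _ _ _) (interchangem _ _ _ _ _) => v v' nat_v lv.
rewrite !mcompA -(mcompA _ _ v) -nat_v !mcompA lv -mlunit_nat -!mcompA.
congr (_ ∘ _); rewrite !mcompA; congr (_ ∘ _).
by rewrite -!tensmM !(comp1m, compm1, tensm1).
Qed.

Definition pi1 := mor O O.
HB.instance Definition _ := gen_eqMixin pi1.
HB.instance Definition _ := gen_choiceMixin pi1.

Definition scale1 (s : pi0) (u : pi1) : pi1 :=
  Lhat (repr0 s) ∘ (idm (repr0 s) ⊠ u) ∘ minv (Lhat (repr0 s)).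

(* the action of s on u can be computed from any object X in s *)
Lemma scale1E (X : A) (u : mor O O) :
  scale1 (cls X) u ∘ Lhat X = Lhat X ∘ (idm X ⊠ u).
Proof.
have /clsP[f] := esym (repr0K (cls X)); rewrite -(Lhat_nat f) /scale1.
by rewrite !mcompA compmVK -!mcompA -!tensmM !compm1 !comp1m.
Qed.

Lemma scale1P (X : A) (u : mor O O) :
  scale1 (cls X) u = Lhat X ∘ (idm X ⊠ u) ∘ minv (Lhat X).
Proof. by rewrite -scale1E compmK. Qed.

Definition add1 (u v : pi1) : pi1 := u ∘ v.
Definition opp1 (u : pi1) : pi1 := minv u.

Fact add1A : associative add1. Proof. exact: mcompA. Qed.
Fact add1C : commutative add1. Proof. exact: aut_comm. Qed.
Fact add10 : left_id (idm O : pi1) add1. Proof. exact: comp1m. Qed.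
Fact add1N : left_inverse (idm O : pi1) opp1 add1. Proof. exact: compVm. Qed.

HB.instance Definition _ := GRing.isZmodule.Build pi1 add1A add1C add10 add1N.

Lemma pi1D (u v : pi1) : u + v = u ∘ v. Proof. by []. Qed.

Fact scale1A (s t : pi0) (u : pi1) : scale1 s (scale1 t u) = scale1 (s * t) u.
Proof.
rewrite -(repr0K s) -(repr0K t) -clsM; set X := repr0 s; set Y := repr0 t.
apply: (compmI (Lhat (X ⊗ Y) ∘ massoc T X Y O)).
rewrite [RHS]mcompA (scale1E (X ⊗ Y)) -[RHS]mcompA -(tensm1 T X Y) -massoc_nat.
rewrite [RHS]mcompA Lhat_mul [LHS]mcompA scale1E -[LHS]mcompA -[RHS]mcompA.
by congr (_ ∘ _); rewrite -!tensmM scale1E.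
Qed.

Fact scale11 : left_id (1 : pi0) scale1.
Proof.
move=> u; apply: (compmI (Lhat I)).
by rewrite scale1E Lhat_one mlunit_nat.
Qed.

Fact scale1Dr (s : pi0) (u v : pi1) : scale1 s (u + v) = scale1 s u + scale1 s v.
Proof.
rewrite -(repr0K s); apply: (compmI (Lhat (repr0 s))).
rewrite scale1E. rewrite !pi1D -mcompA scale1E mcompA scale1E -mcompA.
by rewrite -tensmM comp1m.
Qed.

Fact scale1Dl (u : pi1) (s t : pi0) : scale1 (s + t) u = scale1 s u + scale1 t u.
Proof.
rewrite -(repr0K s) -(repr0K t) -clsD; set X := repr0 s; set Y := repr0 t.
apply: (compmI (Lhat (X ⊕ Y))).
rewrite scale1E Lhat_add -[idm (X ⊕ Y)]tensm1 -[LHS]mcompA Rd_nat.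
rewrite [LHS]mcompA [RHS]mcompA; congr (_ ∘ _).
rewrite pi1D [RHS]mcompA -tens_autE -[LHS]mcompA -[RHS]mcompA -!tensmM.
by rewrite !scale1E.
Qed.

HB.instance Definition _ :=
  GRing.Zmodule_isLmodule.Build pi0 pi1 scale1A scale11 scale1Dr scale1Dl.

End Invariants.

Section ZmodMorphismEq.
Variables (V W : zmodType).
Implicit Types f g : V -> W.

Definition zm f := forall h k, f (h - k) = f h - f k.

Lemma zm0 : zm (fun=> 0). Proof. by move=> h k; rewrite subr0. Qed.
Lemma zmD f g : zm f -> zm g -> zm (fun h => f h + g h).
Proof. by move=> zf zg h k; rewrite zf zg opprD addrACA. Qed.
Lemma zmN f : zm f -> zm (fun h => - f h).
Proof. by move=> zf h k; rewrite zf opprD. Qed.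

Lemma zm_eq0 f g : zm f -> zm g -> f 0 = g 0.
Proof. by move=> zf zg; rewrite -(subr0 0) zf zg !subrr. Qed.
Lemma zm_eqB f g h k : zm f -> zm g ->
  f h = g h -> f k = g k -> f (h - k) = g (h - k).
Proof. by move=> zf zg fgh fgk; rewrite zf zg fgh fgk. Qed.
End ZmodMorphismEq.

Lemma zmZ (R : pzRingType) (V : zmodType) (M : lmodType R) (c : R) (f : V -> M) :
  zm f -> zm (fun h => c *: f h).
Proof. by move=> zf h k; rewrite zf scalerBr. Qed.

Ltac solve_zm :=
  lazymatch goal with
  | |- zm (fun h => 0) => apply zm0
  | |- zm (fun h => @?f h + @?g h) => apply (@zmD _ _ f g); solve_zm
  | |- zm (fun h => - (@?f h)) => apply (@zmN _ _ f); solve_zm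
  | |- zm (fun h => ?c *: @?f h) => apply (@zmZ _ _ _ c f); solve_zm
  | |- _ => by move=> ? ?
  end.

Ltac apply_zm_eq0 z :=
  match goal with |- ?l = ?r =>
    let f := eval pattern z in l in
    let g := eval pattern z in r in
    match f with ?f' _ => match g with ?g' _ =>
      apply: (@zm_eq0 _ _ f' g'); solve_zm end end end.

Ltac apply_zm_eqB hk :=
  match goal with |- ?l = ?r =>
    let f := eval pattern hk in l in
    let g := eval pattern hk in r in
    match f with ?f' _ => match g with ?g' _ =>
      apply: (@zm_eqB _ _ f' g'); [solve_zm | solve_zm | | ] end end end.

Section Cohomology.
Variables (R : comPzRingType) (M : lmodType R).

Definition fun2 := R -> R -> M.
Definition fun3 := R -> R -> R -> M.
HB.instance Definition _ := GRing.Zmodule.copy fun2 (R -> R -> M).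
HB.instance Definition _ := GRing.Zmodule.copy fun3 (R -> R -> R -> M).

(* (xi, eta, alpha, lam, rho) and ((xi, eta, alpha, lam, rho), beta) *)
Definition mac_cochain := (fun3 * fun2 * fun3 * fun3 * fun3)%type.
Definition ab_cochain := (mac_cochain * fun2)%type.
HB.instance Definition _ := GRing.Zmodule.on mac_cochain.
HB.instance Definition _ := GRing.Zmodule.on ab_cochain.

Definition xi (h : mac_cochain) : fun3 := h.1.1.1.1.
Definition eta (h : mac_cochain) : fun2 := h.1.1.1.2.
Definition alpha (h : mac_cochain) : fun3 := h.1.1.2.
Definition lam (h : mac_cochain) : fun3 := h.1.2.
Definition rho (h : mac_cochain) : fun3 := h.2.
Definition mac (k : ab_cochain) : mac_cochain := k.1.
Definition beta (k : ab_cochain) : fun2 := k.2.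

Lemma ab_cochainP (h k : ab_cochain) :
  (forall x y z, xi (mac h) x y z = xi (mac k) x y z) ->
  (forall x y, eta (mac h) x y = eta (mac k) x y) ->
  (forall x y z, alpha (mac h) x y z = alpha (mac k) x y z) ->
  (forall x y z, lam (mac h) x y z = lam (mac k) x y z) ->
  (forall x y z, rho (mac h) x y z = rho (mac k) x y z) ->
  (forall x y, beta h x y = beta k x y) -> h = k.
Proof.
case: h k => [[[[[h1 h2] h3] h4] h5] h6] [[[[[k1 k2] k3] k4] k5] k6].
rewrite /xi /eta /alpha /lam /rho /beta /= => e1 e2 e3 e4 e5 e6.
by do !congr (_, _); apply/funext => x; apply/funext => y; do ?[apply/funext => z].
Qed.

(* M is regarded as a bimodule with m z = z m, so m z is written z *: m. *)
Record is_Z3MacL (h : mac_cochain) : Prop := {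
  S1 : forall x y z t,
    xi h y z t - xi h (x + y) z t + xi h x (y + z) t - xi h x y (z + t)
    + xi h x y z = 0;
  S2 : forall x y z,
    xi h x y z - xi h x z y + xi h z x y + eta h (x + y) z - eta h x z
    - eta h y z = 0;
  S3 : forall x y, eta h x y + eta h y x = 0;
  S4 : forall x y z,
    x *: eta h y z - eta h (x * y) (x * z) = lam h x y z - lam h x z y;
  S5 : forall x y z,
    z *: eta h x y - eta h (x * z) (y * z) = rho h x y z - rho h y x z;
  S6 : forall x y z t,
    x *: xi h y z t - xi h (x * y) (x * z) (x * t)
    = lam h x z t - lam h x (y + z) t + lam h x y (z + t) - lam h x y z;
  S7 : forall x y z t,
    t *: xi h x y z - xi h (x * t) (y * t) (z * t)
    = rho h y z t - rho h (x + y) z t + rho h x (y + z) t - rho h x y t;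
  S8 : forall x y z t,
    rho h x y (z + t) - rho h x y z - rho h x y t
    + lam h x z t + lam h y z t - lam h (x + y) z t
    = - xi h (x * z + x * t) (y * z) (y * t) + xi h (x * z) (x * t) (y * z)
      - eta h (x * t) (y * z) + xi h (x * z + y * z) (x * t) (y * t)
      - xi h (x * z) (y * z) (x * t);
  S9 : forall x y z t,
    alpha h x y (z + t) - alpha h x y z - alpha h x y t
    = x *: lam h y z t + lam h x (y * z) (y * t) - lam h (x * y) z t;
  S10 : forall x y z t,
    alpha h x (y + z) t - alpha h x y t - alpha h x z t
    = x *: rho h y z t - rho h (x * y) (x * z) t + lam h x (y * t) (z * t)
      - t *: lam h x y z;
  S11 : forall x y z t,
    alpha h (x + y) z t - alpha h x z t - alpha h y z t
    = - (t *: rho h x y z) - rho h (x * z) (y * z) t + rho h x y (z * t);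
  S12 : forall x y z t,
    x *: alpha h y z t - alpha h (x * y) z t + alpha h x (y * z) t
    - alpha h x y (z * t) + t *: alpha h x y z = 0;
  xi0 : forall y z, [/\ xi h 0 y z = 0, xi h y 0 z = 0 & xi h y z 0 = 0];
  alpha0 : forall y z,
    [/\ alpha h 0 y z = 0, alpha h y 0 z = 0 & alpha h y z 0 = 0];
  alpha1 : forall y z,
    [/\ alpha h 1 y z = 0, alpha h y 1 z = 0 & alpha h y z 1 = 0];
  lam_norm : forall x y z,
    [/\ lam h 1 y z = 0, lam h 0 y z = 0, lam h x 0 z = 0 & lam h x y 0 = 0];
  rho_norm : forall x y z,
    [/\ rho h x y 1 = 0, rho h 0 y z = 0, rho h x 0 z = 0 & rho h x y 0 = 0] }.

Record is_Z3ab (k : ab_cochain) : Prop := {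
  Z3ab_mac : is_Z3MacL (mac k);
  S20 : forall x y z,
    alpha (mac k) x y z - alpha (mac k) x z y + alpha (mac k) z x y
    - x *: beta k y z + beta k (x * y) z - y *: beta k x z = 0;
  S21 : forall x y z,
    alpha (mac k) x y z - alpha (mac k) y x z + alpha (mac k) y z x
    + y *: beta k x z - beta k x (y * z) + z *: beta k x y = 0;
  S22 : forall x y z,
    beta k x y - beta k x (y + z) + beta k x z
    = rho (mac k) y z x - lam (mac k) x y z }.

Definition Z3ab_pred : {pred ab_cochain} := fun k => `[< is_Z3ab k >].

Fact is_Z3MacL0 : is_Z3MacL 0.
Proof.
split; try by move=> *; apply_zm_eq0 (0 : mac_cochain).
all: by move=> *; split; apply_zm_eq0 (0 : mac_cochain).
Qed.

Fact is_Z3MacLB h k : is_Z3MacL h -> is_Z3MacL k -> is_Z3MacL (h - k).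
Proof.
move=> Zh Zk.
split.
- by move=> x y z t; apply_zm_eqB (h - k); [exact: (S1 Zh)|exact: (S1 Zk)].
- by move=> x y z; apply_zm_eqB (h - k); [exact: (S2 Zh)|exact: (S2 Zk)].
- by move=> x y; apply_zm_eqB (h - k); [exact: (S3 Zh)|exact: (S3 Zk)].
- by move=> x y z; apply_zm_eqB (h - k); [exact: (S4 Zh)|exact: (S4 Zk)].
- by move=> x y z; apply_zm_eqB (h - k); [exact: (S5 Zh)|exact: (S5 Zk)].
- by move=> x y z t; apply_zm_eqB (h - k); [exact: (S6 Zh)|exact: (S6 Zk)].
- by move=> x y z t; apply_zm_eqB (h - k); [exact: (S7 Zh)|exact: (S7 Zk)].
- by move=> x y z t; apply_zm_eqB (h - k); [exact: (S8 Zh)|exact: (S8 Zk)].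
- by move=> x y z t; apply_zm_eqB (h - k); [exact: (S9 Zh)|exact: (S9 Zk)].
- by move=> x y z t; apply_zm_eqB (h - k); [exact: (S10 Zh)|exact: (S10 Zk)].
- by move=> x y z t; apply_zm_eqB (h - k); [exact: (S11 Zh)|exact: (S11 Zk)].
- by move=> x y z t; apply_zm_eqB (h - k); [exact: (S12 Zh)|exact: (S12 Zk)].
- move=> y z; have [? ? ?] := xi0 Zh y z; have [? ? ?] := xi0 Zk y z.
  by split; apply_zm_eqB (h - k).
- move=> y z; have [? ? ?] := alpha0 Zh y z; have [? ? ?] := alpha0 Zk y z.
  by split; apply_zm_eqB (h - k).
- move=> y z; have [? ? ?] := alpha1 Zh y z; have [? ? ?] := alpha1 Zk y z.
  by split; apply_zm_eqB (h - k).
- move=> x y z; have [? ? ? ?] := lam_norm Zh x y z.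
  by have [? ? ? ?] := lam_norm Zk x y z; split; apply_zm_eqB (h - k).
- move=> x y z; have [? ? ? ?] := rho_norm Zh x y z.
  by have [? ? ? ?] := rho_norm Zk x y z; split; apply_zm_eqB (h - k).
Qed.

Fact is_Z3ab0 : is_Z3ab 0.
Proof.
split; first exact: is_Z3MacL0.
- by move=> *; apply_zm_eq0 (0 : ab_cochain).
- by move=> *; apply_zm_eq0 (0 : ab_cochain).
- by move=> *; apply_zm_eq0 (0 : ab_cochain).
Qed.

Fact is_Z3abB h k : is_Z3ab h -> is_Z3ab k -> is_Z3ab (h - k).
Proof.
move=> Zh Zk; split; first exact: is_Z3MacLB (Z3ab_mac Zh) (Z3ab_mac Zk).
- by move=> x y z; apply_zm_eqB (h - k); [exact: (S20 Zh)|exact: (S20 Zk)].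
- by move=> x y z; apply_zm_eqB (h - k); [exact: (S21 Zh)|exact: (S21 Zk)].
- by move=> x y z; apply_zm_eqB (h - k); [exact: (S22 Zh)|exact: (S22 Zk)].
Qed.

Fact Z3ab_zmod_closed : zmod_closed Z3ab_pred.
Proof.
split=> [|h k /asboolP Zh /asboolP Zk]; apply/asboolP; first exact: is_Z3ab0.
exact: is_Z3abB.
Qed.

HB.instance Definition _ := GRing.isZmodClosed.Build ab_cochain Z3ab_pred
  Z3ab_zmod_closed.

Record Z3ab := Z3abOf { Z3ab_val :> ab_cochain; _ : Z3ab_val \in Z3ab_pred }.
HB.instance Definition _ := [isSub for Z3ab_val].
HB.instance Definition _ := [Choice of Z3ab by <:].
HB.instance Definition _ := [SubChoice_isSubZmodule of Z3ab by <:].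

Lemma Z3abP (k : Z3ab) : is_Z3ab k.
Proof. by case: k => k /= /asboolP. Qed.

Definition dMacL (mu nu : fun2) : mac_cochain :=
  (fun x y z => mu y z - mu (x + y) z + mu x (y + z) - mu x y,
   fun x y => mu x y - mu y x,
   fun x y z => x *: nu y z - nu (x * y) z + nu x (y * z) - z *: nu x y,
   fun x y z => nu x (y + z) - nu x y - nu x z + x *: mu y z
                - mu (x * y) (x * z),
   fun x y z => nu (x + y) z - nu x z - nu y z + z *: mu x y
                - mu (x * z) (y * z)).

Definition dab (mu nu : fun2) : ab_cochain :=
  (dMacL mu nu, fun x y => nu x y - nu y x).

Record normalized2 (mu nu : fun2) : Prop := {
  mu0 : forall x y, mu 0 y = 0 /\ mu x 0 = 0;
  nu0 : forall x y, nu 0 y = 0 /\ nu x 0 = 0;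
  nu1 : forall x y, nu 1 y = 0 /\ nu x 1 = 0 }.

Definition is_B3ab (k : Z3ab) : Prop :=
  exists mu nu : fun2, normalized2 mu nu /\ Z3ab_val k = dab mu nu.

Definition B3ab : {pred Z3ab} := fun k => `[< is_B3ab k >].

Fact normalized2B (mu nu mu' nu' : fun2) : normalized2 mu nu ->
  normalized2 mu' nu' -> normalized2 (mu - mu') (nu - nu').
Proof.
by move=> [a b c] [a' b' c']; split=> x y;
  have [? ?] := a x y; have [? ?] := b x y; have [? ?] := c x y;
  have [? ?] := a' x y; have [? ?] := b' x y; have [? ?] := c' x y;
  split; apply_zm_eqB (mu - mu') || apply_zm_eqB (nu - nu').
Qed.

Fact dabB (mu nu mu' nu' : fun2) :
  dab mu nu - dab mu' nu' = dab (mu - mu') (nu - nu').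
Proof.
pose D (g : (fun2 * fun2)%type) := dab g.1 g.2.
have z1 x y z : zm (fun g => xi (mac (D g)) x y z).
  by rewrite /xi /mac /D /dab /dMacL /=; solve_zm.
have z2 x y : zm (fun g => eta (mac (D g)) x y).
  by rewrite /eta /mac /D /dab /dMacL /=; solve_zm.
have z3 x y z : zm (fun g => alpha (mac (D g)) x y z).
  by rewrite /alpha /mac /D /dab /dMacL /=; solve_zm.
have z4 x y z : zm (fun g => lam (mac (D g)) x y z).
  by rewrite /lam /mac /D /dab /dMacL /=; solve_zm.
have z5 x y z : zm (fun g => rho (mac (D g)) x y z).
  by rewrite /rho /mac /D /dab /dMacL /=; solve_zm.
have z6 x y : zm (fun g => beta (D g) x y).
  by rewrite /beta /D /dab /=; solve_zm.
by apply: ab_cochainP => *; apply/esym;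
  [apply: (z1 _ _ _ (mu, nu) (mu', nu'))|apply: (z2 _ _ (mu, nu) (mu', nu'))
  |apply: (z3 _ _ _ (mu, nu) (mu', nu'))|apply: (z4 _ _ _ (mu, nu) (mu', nu'))
  |apply: (z5 _ _ _ (mu, nu) (mu', nu'))|apply: (z6 _ _ (mu, nu) (mu', nu'))].
Qed.

Fact is_B3ab0 : is_B3ab 0.
Proof.
exists 0, 0; split; first by split.
by have := dabB 0 0 0 0; rewrite !subrr.
Qed.

Fact is_B3abB h k : is_B3ab h -> is_B3ab k -> is_B3ab (h - k).
Proof.
move=> [mu [nu [n e]]] [mu' [nu' [n' e']]].
exists (mu - mu'), (nu - nu'); split; first exact: normalized2B.
by rewrite -dabB -e -e'.
Qed.

Fact B3ab_zmod_closed : zmod_closed B3ab.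
Proof.
split=> [|h k /asboolP Bh /asboolP Bk]; apply/asboolP; first exact: is_B3ab0.
exact: is_B3abB.
Qed.

HB.instance Definition _ := GRing.isZmodClosed.Build Z3ab B3ab B3ab_zmod_closed.

Definition H3ab := Quotient.quot B3ab.
HB.instance Definition _ := GRing.Zmodule.on H3ab.

Definition H3class (k : Z3ab) : H3ab := \pi_(H3ab) k.

Lemma H3classP (k k' : Z3ab) : H3class k = H3class k' <-> is_B3ab (k - k').
Proof.
split=> [/eqP|kk']; last apply/eqP.
  by rewrite piE => /asboolP.
by rewrite piE; apply/asboolP.
Qed.

End Cohomology.
Arguments Z3ab_pred {R M}.
Arguments B3ab {R M}.

Section Transport.
Variables (R R' : comPzRingType) (M : lmodType R) (M' : lmodType R').
Variables (p : {rmorphism R -> R'}) (f : {additive M' -> M}).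
Hypothesis fZ : forall s u, f (p s *: u) = s *: f u.

Definition transport_cochain (k : ab_cochain M') : ab_cochain M :=
  ((fun x y z => f (xi (mac k) (p x) (p y) (p z)),
    fun x y => f (eta (mac k) (p x) (p y)),
    fun x y z => f (alpha (mac k) (p x) (p y) (p z)),
    fun x y z => f (lam (mac k) (p x) (p y) (p z)),
    fun x y z => f (rho (mac k) (p x) (p y) (p z))),
   fun x y => f (beta k (p x) (p y))).

Let fE := (raddf0, raddfB, raddfD, raddfN, fZ).
Let pE := (rmorph0, rmorph1, rmorphD, rmorphM).

Fact transport_Z3MacL k : is_Z3MacL (mac k) -> is_Z3MacL (mac (transport_cochain k)).
Proof.
rewrite /transport_cochain /mac /= => Zk; split; rewrite /xi /eta /alpha /lam /rho /=.
- by move=> x y z t; rewrite ?pE; have := congr1 f (S1 Zk (p x) (p y) (p z) (p t)); rewrite ?fE.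
- by move=> x y z; rewrite ?pE; have := congr1 f (S2 Zk (p x) (p y) (p z)); rewrite ?fE.
- by move=> x y; rewrite ?pE; have := congr1 f (S3 Zk (p x) (p y)); rewrite ?fE.
- by move=> x y z; rewrite ?pE; have := congr1 f (S4 Zk (p x) (p y) (p z)); rewrite ?fE.
- by move=> x y z; rewrite ?pE; have := congr1 f (S5 Zk (p x) (p y) (p z)); rewrite ?fE.
- by move=> x y z t; rewrite ?pE; have := congr1 f (S6 Zk (p x) (p y) (p z) (p t)); rewrite ?fE.
- by move=> x y z t; rewrite ?pE; have := congr1 f (S7 Zk (p x) (p y) (p z) (p t)); rewrite ?fE.
- by move=> x y z t; rewrite ?pE; have := congr1 f (S8 Zk (p x) (p y) (p z) (p t)); rewrite ?fE.
- by move=> x y z t; rewrite ?pE; have := congr1 f (S9 Zk (p x) (p y) (p z) (p t)); rewrite ?fE.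
- by move=> x y z t; rewrite ?pE; have := congr1 f (S10 Zk (p x) (p y) (p z) (p t)); rewrite ?fE.
- by move=> x y z t; rewrite ?pE; have := congr1 f (S11 Zk (p x) (p y) (p z) (p t)); rewrite ?fE.
- by move=> x y z t; rewrite ?pE; have := congr1 f (S12 Zk (p x) (p y) (p z) (p t)); rewrite ?fE.
- by move=> y z; rewrite !pE; case: (xi0 Zk (p y) (p z)) => /(congr1 f) e1 /(congr1 f) e2
    /(congr1 f) e3; rewrite raddf0 in e1 e2 e3.
- by move=> y z; rewrite !pE; case: (alpha0 Zk (p y) (p z)) => /(congr1 f) e1 /(congr1 f) e2
    /(congr1 f) e3; rewrite raddf0 in e1 e2 e3.
- by move=> y z; rewrite !pE; case: (alpha1 Zk (p y) (p z)) => /(congr1 f) e1 /(congr1 f) e2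
    /(congr1 f) e3; rewrite raddf0 in e1 e2 e3.
- by move=> x y z; rewrite !pE; case: (lam_norm Zk (p x) (p y) (p z)) => /(congr1 f) e1
    /(congr1 f) e2 /(congr1 f) e3 /(congr1 f) e4; rewrite raddf0 in e1 e2 e3 e4.
- by move=> x y z; rewrite !pE; case: (rho_norm Zk (p x) (p y) (p z)) => /(congr1 f) e1
    /(congr1 f) e2 /(congr1 f) e3 /(congr1 f) e4; rewrite raddf0 in e1 e2 e3 e4.
Qed.

Fact transport_Z3ab k : is_Z3ab k -> is_Z3ab (transport_cochain k).
Proof.
move=> Zk; split; first exact: transport_Z3MacL (Z3ab_mac Zk).
all: rewrite /transport_cochain /mac /alpha /lam /rho /beta /=.
- by move=> x y z; rewrite ?pE; have := congr1 f (S20 Zk (p x) (p y) (p z)); rewrite ?fE.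
- by move=> x y z; rewrite ?pE; have := congr1 f (S21 Zk (p x) (p y) (p z)); rewrite ?fE.
- by move=> x y z; rewrite ?pE; have := congr1 f (S22 Zk (p x) (p y) (p z)); rewrite ?fE.
Qed.

Fact transport_subproof (k : Z3ab M') : transport_cochain k \in Z3ab_pred.
Proof. by apply/asboolP/transport_Z3ab/Z3abP. Qed.

Lemma transport_cochainB h k :
  transport_cochain (h - k) = transport_cochain h - transport_cochain k.
Proof.
apply: ab_cochainP => x y *;
  [ exact: (raddfB f (xi (mac h) (p x) (p y) _) (xi (mac k) _ _ _))
  | exact: (raddfB f (eta (mac h) (p x) (p y)) (eta (mac k) _ _))
  | exact: (raddfB f (alpha (mac h) (p x) (p y) _) (alpha (mac k) _ _ _))
  | exact: (raddfB f (lam (mac h) (p x) (p y) _) (lam (mac k) _ _ _))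
  | exact: (raddfB f (rho (mac h) (p x) (p y) _) (rho (mac k) _ _ _))
  | exact: (raddfB f (beta h (p x) (p y)) (beta k _ _)) ].
Qed.

Lemma transport_dab (mu nu : fun2 M') :
  transport_cochain (dab mu nu)
  = dab (fun x y => f (mu (p x) (p y))) (fun x y => f (nu (p x) (p y))).
Proof.
apply: ab_cochainP => x y *;
  rewrite /transport_cochain /dab /dMacL /mac /xi /eta /alpha /lam /rho /beta /=;
  by rewrite ?pE ?fE.
Qed.

Definition Z3transport (k : Z3ab M') : Z3ab M := Z3abOf (transport_subproof k).

Definition H3transport (c : H3ab M') : H3ab M := H3class (Z3transport (repr c)).

Lemma H3transportE (k : Z3ab M') : H3transport (H3class k) = H3class (Z3transport k).
Proof.
set k' := repr (H3class k).
have /H3classP[mu [nu [[mu0 nu0 nu1] e]]] : H3class k' = H3class k by exact: reprK.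
apply/H3classP.
exists (fun x y => f (mu (p x) (p y))), (fun x y => f (nu (p x) (p y))); split.
  by split=> x y; rewrite !pE; [have [-> ->] := mu0 (p x) (p y)
    | have [-> ->] := nu0 (p x) (p y)| have [-> ->] := nu1 (p x) (p y)];
    rewrite raddf0.
rewrite -transport_dab -[dab mu nu]e.
exact/esym/transport_cochainB.
Qed.

End Transport.

Section Stick.
Variable A : brAnnCat.
Local Notation S := (ann_add A).
Local Notation T := (ann_mul A).
Local Notation "X ⊕ Y" := (tens S X Y) : cat_scope.
Local Notation "f ⊞ g" := (tensm S f g) : cat_scope.
Local Notation "X ⊗ Y" := (tens T X Y) : cat_scope.
Local Notation "f ⊠ g" := (tensm T f g) : cat_scope.

(* The equations between objects X_0 = 0, X_{0 + t} = X_t, etc. are coerced to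
   morphisms by eqm. *)
Record stick := Stick {
  rep :> pi0 A -> A;
  rep_cls : forall s, cls (rep s) = s;
  rep0 : rep 0 = munit S;
  rep1 : rep 1 = munit T;
  phi : forall s t, mor (rep s ⊕ rep t) (rep (s + t));
  psi : forall s t, mor (rep s ⊗ rep t) (rep (s * t));
  phi0l : forall t, eqm (congr1 rep (add0r t)) ∘ phi 0 t
    = mlunit S (rep t) ∘ (eqm rep0 ⊞ idm (rep t));
  phi0r : forall s, eqm (congr1 rep (addr0 s)) ∘ phi s 0
    = mrunit S (rep s) ∘ (idm (rep s) ⊞ eqm rep0);
  psi1l : forall t, eqm (congr1 rep (mul1r t)) ∘ psi 1 t
    = mlunit T (rep t) ∘ (eqm rep1 ⊠ idm (rep t));
  psi1r : forall s, eqm (congr1 rep (mulr1 s)) ∘ psi s 1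
    = mrunit T (rep s) ∘ (idm (rep s) ⊠ eqm rep1);
  psi0l : forall t, eqm (etrans (congr1 rep (mul0r t)) rep0) ∘ psi 0 t
    = Rhat (rep t) ∘ (eqm rep0 ⊠ idm (rep t));
  psi0r : forall s, eqm (etrans (congr1 rep (mulr0 s)) rep0) ∘ psi s 0
    = Lhat (rep s) ∘ (idm (rep s) ⊠ eqm rep0) }.

(* k is the family of functions defining the constraints of the category sA for
   which (H, phi, psi, id), with H(s) = X_s and H(s, u) = gamma_{X_s}(u), is
   compatible with the constraints of sA and of A. The morphism eqm identifies
   the images under H of the (equal) source and target of a constraint of sA. *)
Record induced (X : stick) (k : ab_cochain (pi1 A)) : Prop := {
  induced_xi : forall r s t,
    eqm (congr1 X (addrA r s t)) ∘ gamma (X (r + (s + t))) (xi (mac k) r s t)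
      ∘ phi X r (s + t) ∘ (idm (X r) ⊞ phi X s t)
    = phi X (r + s) t ∘ (phi X r s ⊞ idm (X t)) ∘ massoc S (X r) (X s) (X t);
  induced_eta : forall r s,
    eqm (congr1 X (addrC r s)) ∘ gamma (X (r + s)) (eta (mac k) r s) ∘ phi X r s
    = phi X s r ∘ sbr S (X r) (X s);
  induced_alpha : forall r s t,
    eqm (congr1 X (mulrA r s t)) ∘ gamma (X (r * (s * t))) (alpha (mac k) r s t)
      ∘ psi X r (s * t) ∘ (idm (X r) ⊠ psi X s t)
    = psi X (r * s) t ∘ (psi X r s ⊠ idm (X t)) ∘ massoc T (X r) (X s) (X t);
  induced_lam : forall r s t,
    eqm (congr1 X (mulrDr r s t)) ∘ gamma (X (r * (s + t))) (lam (mac k) r s t)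
      ∘ psi X r (s + t) ∘ (idm (X r) ⊠ phi X s t)
    = phi X (r * s) (r * t) ∘ (psi X r s ⊞ psi X r t)
      ∘ Ld (ann_distr A) (X r) (X s) (X t);
  induced_rho : forall r s t,
    eqm (congr1 X (mulrDl r s t)) ∘ gamma (X ((r + s) * t)) (rho (mac k) r s t)
      ∘ psi X (r + s) t ∘ (phi X r s ⊠ idm (X t))
    = phi X (r * t) (s * t) ∘ (psi X r t ⊞ psi X s t)
      ∘ Rd (ann_distr A) (X r) (X s) (X t);
  induced_beta : forall r s,
    eqm (congr1 X (mulrC r s)) ∘ gamma (X (r * s)) (beta k r s) ∘ psi X r s
    = psi X s r ∘ brann_br A (X r) (X s) }.

(* c is the class of the element of Z^3_ab(pi_0 A, pi_1 A) induced by a stick *)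
Definition is_class (c : H3ab (pi1 A)) : Prop :=
  exists (X : stick) (k : Z3ab (pi1 A)), induced X k /\ c = H3class k.

End Stick.

Section FunctorInvariants.
Variables (A B : brAnnCat) (F : brAnnFunctor A B).

Definition F0 (s : pi0 A) : pi0 B := cls (F (repr0 s)).

Lemma F0_cls (X : A) : F0 (cls X) = cls (F X).
Proof. by have /clsP[f] := repr0K (cls X); apply: hom_cls (fmap F f). Qed.

Definition F1 (u : pi1 A) : pi1 B := gammaV (fmap F (u : mor _ _)).

End FunctorInvariants.

Section PreStick.
Variables (R : comPzRingType) (M : lmodType R).

Record preStick (A : brAnnCat) := PreStick {
  ps_p : {rmorphism R -> pi0 A};
  ps_q : {additive M -> pi1 A};
  ps_p_bij : bijective ps_p;
  ps_q_bij : bijective ps_q;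
  ps_qZ : forall (s : R) (u : M), ps_q (s *: u) = ps_p s *: ps_q u }.

Record brAnnPS := BrAnnPS { bps_car :> brAnnCat; bps_ps : preStick bps_car }.

Local Notation p A := (ps_p (bps_ps A)).
Local Notation q A := (ps_q (bps_ps A)).

Definition ps_morphism (A B : brAnnPS) (F : brAnnFunctor A B) : Prop :=
  (forall s : R, F0 F (p A s) = p B s) /\ (forall u : M, F1 F (q A u) = q B u).

(* [A] is the set of all B such that there is a morphism from A to B; since such
   morphisms are equivalences, this relation is an equivalence relation. *)
Definition BrAnn_class (A : brAnnPS) : brAnnPS -> Prop :=
  fun B => exists F : brAnnFunctor A B, @ps_morphism A B F.

Definition BrAnn := {K : brAnnPS -> Prop | exists A, K = BrAnn_class A}.

Definition to_BrAnn (A : brAnnPS) : BrAnn :=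
  exist _ (BrAnn_class A) (ex_intro _ A erefl).

Section Qinv.
Variable A : brAnnPS.

Fact q_surj (v : pi1 A) : exists u, q A u = v.
Proof. by have [g _ gK] := ps_q_bij (bps_ps A); exists (g v). Qed.

Definition qV (v : pi1 A) : M := projT1 (cid (q_surj v)).

Lemma qVK : cancel qV (q A).
Proof. by move=> v; rewrite /qV; case: cid. Qed.

Lemma qK : cancel (q A) qV.
Proof. by move=> u; apply: (bij_inj (ps_q_bij (bps_ps A))); rewrite qVK. Qed.

Fact qV_zmod_morphism : zmod_morphism qV.
Proof. exact: can2_zmod_morphism qK qVK. Qed.

HB.instance Definition _ :=
  GRing.isZmodMorphism.Build (pi1 A) M qV qV_zmod_morphism.

Fact qVZ (s : R) (v : pi1 A) : qV (p A s *: v) = s *: qV v.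
Proof. by apply: (can_inj qK); rewrite ps_qZ !qVK. Qed.

(* q_*^{-1} p^* *)
Definition ps_transport : H3ab (pi1 A) -> H3ab M := H3transport qVZ.
End Qinv.

End PreStick.

(* Main.v *)
From HB Require Import structures.
Require Import Defs.
From mathcomp Require Import all_boot all_algebra.
From mathcomp Require Import boolp classical_sets functions.
From mathcomp Require Import ring.

(** The proof puts coordinates on a braided Ann-category A with pre-stick (p, q)
of type (R, M). Choosing an isomorphism from every object to a representative of
its class attaches to each morphism f a degree in M, additive under composition.
Two parallel morphisms are equal as soon as their degrees are, and between two
objects of one class every element of M is a degree, so equations between
morphisms become linear equations in M. The constraints of A then have degrees
of the form
  (an element of M that only depends on the classes of the objects)
    + (potential of the source) - (potential of the target),
and the elements in question, for a+, c+, a, L, R and c, are the values of a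
cochain k on R. The degree of a sum or a product of two morphisms has the same
form, with their degrees, weighted by classes for a product, in place of the
value of k. Such data form a chart of A with cochain k ([chart]).

Everything reduces to charts.
- The degree of each coherence axiom is one cocycle identity, so k is an abelian
  3-cocycle ([chart_Z3ab]).
- If A and B have charts with cochains k and k', a morphism from A to B exists
  if and only if k - k' is a coboundary. From the coboundary of (mu, nu), the
  functor takes X to a representative in B of the class of X, preserves degrees,
  and has structure isomorphisms of degrees - mu and - nu up to potentials
  ([chart_brAnnFunctor]). Conversely the structure isomorphisms of a functor
  have such degrees, for some mu and nu that can be normalized afterwards
  ([ps_morphism_cobounds], [cobounds_normalized]). Hence the class of k does not
  depend on the chart, and two braided Ann-categories with pre-stick are in the
  same class if and only if they have the same class of k.
- A stick with its induced cochain gives a chart ([stick_chart]), whose cochain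
  is the induced one transported along p and q, so the invariant is the one in
  the theorem. Sticks exist when 1 and 0 are different in R ([class_exists]);
  when R is trivial so is M, and a chart with all degrees and potentials equal
  to zero exists.
- Every cocycle k is the cochain of a chart of the category with set of objects
  R, automorphism groups M and constraints k ([skel_chart]), so the invariant
  takes all values. *)

Set Implicit Arguments.
Unset Strict Implicit.
Unset Printing Implicit Defensive.

Import GRing.Theory.
Local Open Scope ring_scope.
Local Open Scope cat_scope.

Local Notation S A := (ann_add A).
Local Notation T A := (ann_mul A).
Local Notation "X ⊕ Y" := (tens (S _) X Y) : cat_scope.
Local Notation "f ⊞ g" := (tensm (S _) f g) : cat_scope.
Local Notation "X ⊗ Y" := (tens (T _) X Y) : cat_scope.
Local Notation "f ⊠ g" := (tensm (T _) f g) : cat_scope.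

(** * Linear identities in a module *)

(** The square-zero extension of R by M: a commutative ring that contains M, in
which identities between R-linear combinations of elements of M become ring
identities. *)
Definition sqzext (R : comPzRingType) (M : lmodType R) : Type := (R * M)%type.

Section SquareZeroExtension.
Variables (R : comPzRingType) (M : lmodType R).
Local Notation E := (sqzext M).

HB.instance Definition _ := GRing.Zmodule.on E.

Definition sqz_mul (a b : E) : E := (a.1 * b.1, a.1 *: b.2 + b.1 *: a.2).
Fact sqz_mulA : associative sqz_mul.
Proof.
move=> a b c; congr (_, _); rewrite /= ?mulrA //.
by rewrite !scalerDr !scalerA addrA [c.1 * a.1]mulrC [c.1 * b.1]mulrC -!scalerA.
Qed.
Fact sqz_mulC : commutative sqz_mul.
Proof. by move=> a b; rewrite /sqz_mul mulrC addrC. Qed.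
Fact sqz_mul1 : left_id ((1, 0) : E) sqz_mul.
Proof. by case=> r u; rewrite /sqz_mul /= mul1r scale1r scaler0 addr0. Qed.
Fact sqz_mulD : left_distributive sqz_mul +%R.
Proof.
move=> a b c; congr (_, _); rewrite /= ?mulrDl // scalerDl scalerDr.
by rewrite addrACA.
Qed.
HB.instance Definition _ :=
  GRing.Zmodule_isComPzRing.Build E sqz_mulA sqz_mulC sqz_mul1 sqz_mulD.

Definition sqz_in (u : M) : E := (0, u).
Definition sqz_scal (r : R) : E := (r, 0).

Fact sqz_in_zmod : zmod_morphism sqz_in.
Proof. by move=> u v; congr (_, _); rewrite subr0. Qed.
HB.instance Definition _ := GRing.isZmodMorphism.Build M E sqz_in sqz_in_zmod.
Fact sqz_scal_zmod : zmod_morphism sqz_scal.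
Proof. by move=> u v; congr (_, _); rewrite subr0. Qed.
HB.instance Definition _ := GRing.isZmodMorphism.Build R E sqz_scal sqz_scal_zmod.
Fact sqz_scal_monoid : monoid_morphism sqz_scal.
Proof. by split=> // r s; congr (_, _); rewrite /= !scaler0 addr0. Qed.
HB.instance Definition _ :=
  GRing.isMonoidMorphism.Build R E sqz_scal sqz_scal_monoid.

Lemma sqz_inZ r u : sqz_in (r *: u) = sqz_scal r * sqz_in u.
Proof. by congr (_, _); rewrite /= ?mulr0 // scaler0 addr0. Qed.
Lemma sqz_inD u v : sqz_in (u + v) = sqz_in u + sqz_in v.
Proof. exact: raddfD. Qed.
Lemma sqz_inN u : sqz_in (- u) = - sqz_in u.
Proof. exact: raddfN. Qed.
Lemma sqz_in0 : sqz_in 0 = 0. Proof. by []. Qed.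
Lemma sqz_in_inj : injective sqz_in.
Proof. by move=> u v []. Qed.

(** Used to subtract the equation [a = b] from the goal [c = d]. *)
Lemma lincomb (a b c d : M) : a = b -> c + b = d + a -> c = d.
Proof. by move=> -> /addIr. Qed.
End SquareZeroExtension.

(** [mring] decides linear identities in a module; [lin e] subtracts the equation
[e] from the goal, and [lin1 e] closes a goal that is [e] or its opposite up to
such an identity. *)
Ltac mring :=
  apply: sqz_in_inj; rewrite ?(sqz_inD, sqz_inN, sqz_inZ, sqz_in0); ring.
Tactic Notation "lin" constr(e) := refine (lincomb e _).
Ltac lin1 e := first [lin e; mring | lin (esym e); mring].

(** * Automorphisms and zero constraints in a braided Ann-category *)

Section EqMor.
Variable C : groupoid.

Lemma eqm_loop (Y : C) (e : Y = Y) : eqm e = idm Y.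
Proof. by rewrite (Prop_irrelevance e erefl). Qed.

Lemma eqmV (Y Z : C) (e : Y = Z) : minv (eqm e) = eqm (esym e).
Proof. by case: Z / e; rewrite /= minv1. Qed.

Lemma eqmM (Y Z W : C) (e : Y = Z) (e' : Z = W) :
  eqm e' ∘ eqm e = eqm (etrans e e').
Proof. by case: W / e'; rewrite comp1m. Qed.
End EqMor.

Section GammaTheory.
Variable A : brAnnCat.
Local Notation O := (munit (S A)).
Local Notation I := (munit (T A)).
Implicit Types u v : pi1 A.

Lemma gamma_nat (Y Z : A) (f : mor Y Z) u : gamma Z u ∘ f = f ∘ gamma Y u.
Proof.
apply: (compmI (mlunit (S A) Y)); rewrite -[LHS]mcompA -[RHS]mcompA gammaE.
rewrite [RHS]mcompA -mlunit_nat [LHS]mcompA gammaE -!mcompA.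
by rewrite tensmlr tensmrl.
Qed.

Lemma gammaD (Y : A) u v : gamma Y (u + v) = gamma Y u ∘ gamma Y v.
Proof.
rewrite pi1D /gamma !mcompA compmVK; congr (_ ∘ _).
by rewrite -!mcompA -tensmM comp1m.
Qed.

Lemma gamma_addl (Y Z : A) u : gamma Y u ⊞ idm Z = gamma (Y ⊕ Z) u.
Proof.
apply: (compmI (mlunit (S A) (Y ⊕ Z))); rewrite gammaE -mlunit_tens mcompA -tensmM.
rewrite gammaE comp1m -[idm Z in LHS]comp1m tensmM -!mcompA; congr (_ ∘ _).
by rewrite -massoc_nat tensm1.
Qed.

Lemma gamma_addr (Y Z : A) u : idm Y ⊞ gamma Z u = gamma (Y ⊕ Z) u.
Proof.
apply: (compIm (sbr (S A) Y Z)).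
by rewrite br_nat gamma_addl gamma_nat.
Qed.

Lemma gamma_add (Y Z : A) u v : gamma Y u ⊞ gamma Z v = gamma (Y ⊕ Z) (u + v).
Proof. by rewrite -tensmlr gamma_addl gamma_addr gammaD. Qed.

Lemma gamma_mulr (Y Z : A) u : idm Y ⊠ gamma Z u = gamma (Y ⊗ Z) (cls Y *: u).
Proof.
apply: (compmI (idm Y ⊠ mlunit (S A) Z)).
rewrite -ltens_fmapM gammaE ltens_fmapM -LhatE -!mcompA Ld_nat tensm1.
rewrite !mcompA gammaE; congr (_ ∘ _); rewrite -!mcompA; congr (_ ∘ _).
by rewrite -!tensmM -scale1E.
Qed.

(** The right action of pi_0 on pi_1 is carried to the left one by the
braiding. *)
Lemma gamma_mull (Y Z : A) u : gamma Y u ⊠ idm Z = gamma (Y ⊗ Z) (cls Z *: u).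
Proof.
apply: (compIm (brann_br A Y Z)).
by rewrite br_nat gamma_mulr gamma_nat.
Qed.

Lemma gamma_mul (Y Z : A) u v :
  gamma Y u ⊠ gamma Z v = gamma (Y ⊗ Z) (cls Y *: v + cls Z *: u).
Proof. by rewrite -tensmrl gamma_mull gamma_mulr gammaD. Qed.

Lemma gamma0 (Y : A) : gamma Y (0 : pi1 A) = idm Y.
Proof. by rewrite /gamma tensm1 compm1 compmV. Qed.

Lemma gammaVM (Y : A) (f g : mor Y Y) :
  gammaV (f ∘ g) = (gammaV f : pi1 A) + gammaV g.
Proof. by apply: (@gamma_inj _ Y); rewrite gammaD !gammaVK. Qed.

(** The braiding turns the left distributivity into the right one, hence the zero
constraint on the left into that on the right. *)
Lemma Rhat_br (Y : A) : Rhat Y ∘ brann_br A Y O = Lhat Y.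
Proof.
apply: (@Lhat_eq A Y O); apply: (compIm (brann_br A Y O)).
rewrite br_nat -RhatE !mcompA -mlunit_nat -[RHS]mcompA brann_distr.
rewrite [RHS]mcompA -!(mcompA (mlunit (S A) _)) -!tensmM.
by rewrite !comp1m !compm1.
Qed.

Lemma Rhat_nat (Y Z : A) (f : mor Y Z) : Rhat Z ∘ (idm O ⊠ f) = Rhat Y.
Proof.
apply: (compmI (brann_br A Y O)).
by rewrite Rhat_br -mcompA -br_nat mcompA Rhat_br Lhat_nat.
Qed.

(** The two values that a stick prescribes for [psi 0 0] agree: this is where
c_{0,0} = id enters. *)
Lemma Rhat_zero : Rhat O = Lhat O.
Proof. by rewrite -Rhat_br brann_br00 compm1. Qed.

Lemma gamma_unit u : gamma O u = u.
Proof. by rewrite /gamma tens_autE compm1 compmK. Qed.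

Lemma Rhat_one : Rhat I = mrunit (T A) O.
Proof.
apply/esym; have : mlunit (S A) (O ⊗ I) ∘ (mrunit (T A) O ⊞ idm (O ⊗ I))
    ∘ Rd (ann_distr A) O O I = mlunit (S A) O ⊠ idm I.
  apply: (compIm (mrunit (T A) O)).
  rewrite mrunit_nat -(Rd_unit (ann_distr A)) !mcompA -mlunit_nat.
  by congr (_ ∘ _); rewrite -!mcompA -tensmM comp1m compm1.
by rewrite -RhatE => /compmI/compIm/tensr_inj.
Qed.

End GammaTheory.

Section PreStickTheory.
Variables (R : comPzRingType) (M : lmodType R) (A : brAnnPS M).
Local Notation p := (ps_p (bps_ps A)).

Lemma p_inj : injective p. Proof. exact: bij_inj (ps_p_bij _). Qed.

Lemma p_surj (s : pi0 A) : exists x, p x = s.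
Proof. by have [g _ gK] := ps_p_bij (bps_ps A); exists (g s). Qed.

Definition p_inv (s : pi0 A) : R := projT1 (cid (p_surj s)).

Lemma p_invK s : p (p_inv s) = s.
Proof. by rewrite /p_inv; case: cid. Qed.

Lemma pi0_nontrivial : (1 : R) != 0 -> (1 : pi0 A) != 0.
Proof. by rewrite -(rmorph1 p) -(rmorph0 p) (inj_eq p_inj). Qed.

End PreStickTheory.

(** * Charts *)

Section Charts.
Variables (R : comPzRingType) (M : lmodType R).

(** [pot_add X Y] and [pot_mul X Y] are the potentials of X ⊕ Y and X ⊗ Y, and
[pot_zero], [pot_one] those of the two unit objects. Potentials of iterated
products add up, a potential being multiplied by the classes of the other
factors: that of X ⊗ (Y ⊗ Z), for instance, is
[pot_mul X (Y ⊗ Z) + ring_cls X *: pot_mul Y Z]. With this in mind the field on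
each constraint reads: degree = value of the cochain (zero for the unit and zero
constraints) + potential of the source - potential of the target. *)
Record chart (A : brAnnPS M) (k : ab_cochain M) := Chart {
  ring_cls : A -> R;
  deg : forall X Y : A, mor X Y -> M;
  pot_add : A -> A -> M;
  pot_mul : A -> A -> M;
  pot_zero : M;
  pot_one : M;
  ring_clsE : forall X, ps_p (bps_ps A) (ring_cls X) = cls X;
  degM : forall X Y Z (g : mor Y Z) (f : mor X Y), deg (g ∘ f) = deg g + deg f;
  deg_gamma : forall X u, deg (gamma X u) = qV (u : pi1 A);
  deg_tensS : forall X X' Y Y' (f : mor X X') (g : mor Y Y'),
    deg (f ⊞ g) = deg f + deg g + pot_add X Y - pot_add X' Y';
  deg_tensT : forall X X' Y Y' (f : mor X X') (g : mor Y Y'),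
    deg (f ⊠ g) = ring_cls X *: deg g + ring_cls Y *: deg f
      + pot_mul X Y - pot_mul X' Y';
  deg_assocS : forall X Y Z, deg (massoc (S A) X Y Z)
    = xi (mac k) (ring_cls X) (ring_cls Y) (ring_cls Z)
      + pot_add X (Y ⊕ Z) + pot_add Y Z - pot_add (X ⊕ Y) Z - pot_add X Y;
  deg_brS : forall X Y, deg (sbr (S A) X Y)
    = eta (mac k) (ring_cls X) (ring_cls Y) + pot_add X Y - pot_add Y X;
  deg_assocT : forall X Y Z, deg (massoc (T A) X Y Z)
    = alpha (mac k) (ring_cls X) (ring_cls Y) (ring_cls Z)
      + pot_mul X (Y ⊗ Z) + ring_cls X *: pot_mul Y Z
      - pot_mul (X ⊗ Y) Z - ring_cls Z *: pot_mul X Y;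
  deg_Ld : forall X Y Z, deg (Ld (ann_distr A) X Y Z)
    = lam (mac k) (ring_cls X) (ring_cls Y) (ring_cls Z)
      + pot_mul X (Y ⊕ Z) + ring_cls X *: pot_add Y Z
      - pot_add (X ⊗ Y) (X ⊗ Z) - pot_mul X Y - pot_mul X Z;
  deg_Rd : forall X Y Z, deg (Rd (ann_distr A) X Y Z)
    = rho (mac k) (ring_cls X) (ring_cls Y) (ring_cls Z)
      + pot_mul (X ⊕ Y) Z + ring_cls Z *: pot_add X Y
      - pot_add (X ⊗ Z) (Y ⊗ Z) - pot_mul X Z - pot_mul Y Z;
  deg_brT : forall X Y, deg (brann_br A X Y)
    = beta k (ring_cls X) (ring_cls Y) + pot_mul X Y - pot_mul Y X;
  deg_lunitS : forall X,
    deg (mlunit (S A) X) = pot_add (munit (S A)) X + pot_zero;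
  deg_runitS : forall X,
    deg (mrunit (S A) X) = pot_add X (munit (S A)) + pot_zero;
  deg_lunitT : forall X, deg (mlunit (T A) X)
    = pot_mul (munit (T A)) X + ring_cls X *: pot_one;
  deg_runitT : forall X, deg (mrunit (T A) X)
    = pot_mul X (munit (T A)) + ring_cls X *: pot_one;
  deg_Lhat : forall X, deg (@Lhat A X)
    = pot_mul X (munit (S A)) + ring_cls X *: pot_zero - pot_zero;
  deg_Rhat : forall X, deg (@Rhat A X)
    = pot_mul (munit (S A)) X + ring_cls X *: pot_zero - pot_zero }.

Section ChartTheory.
Variables (A : brAnnPS M) (k : ab_cochain M) (c : chart A k).
Local Notation p := (ps_p (bps_ps A)).
Local Notation r := (ring_cls c).
Local Notation d := (deg c).
Local Notation a := (alpha (mac k)).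

Lemma ring_cls_surj x : exists X, r X = x.
Proof. by exists (repr0 (p x)); apply: (@p_inj _ _ A); rewrite ring_clsE repr0K. Qed.

Lemma ring_cls_mor X Y (f : mor X Y) : r X = r Y.
Proof. by apply: (@p_inj _ _ A); rewrite !ring_clsE; apply: hom_cls f. Qed.

Lemma ring_cls_hom X Y : r X = r Y -> inhabited (mor X Y).
Proof. by move=> e; apply/clsP; rewrite -!(ring_clsE c) e. Qed.

Lemma ring_clsD X Y : r (X ⊕ Y) = r X + r Y.
Proof. by apply: (@p_inj _ _ A); rewrite rmorphD !ring_clsE clsD. Qed.

Lemma ring_clsM X Y : r (X ⊗ Y) = r X * r Y.
Proof. by apply: (@p_inj _ _ A); rewrite rmorphM !ring_clsE clsM. Qed.

Lemma ring_cls0 : r (munit (S A)) = 0.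
Proof. by apply: (@p_inj _ _ A); rewrite rmorph0 ring_clsE. Qed.

Lemma ring_cls1 : r (munit (T A)) = 1.
Proof. by apply: (@p_inj _ _ A); rewrite rmorph1 ring_clsE. Qed.

Lemma deg1 X : d (idm X) = 0.
Proof. by apply: (addrI (d (idm X))); rewrite -degM comp1m addr0. Qed.

Lemma degV X Y (f : mor X Y) : d (minv f) = - d f.
Proof. by apply: (addIr (d f)); rewrite -degM compVm deg1 addNr. Qed.

(** Parallel morphisms differ by an automorphism gamma_X(u), whose degree is the
element of M that corresponds to u; hence the degree is faithful, and full
between objects of one class. *)
Lemma deg_inj X Y (f g : mor X Y) : d f = d g -> f = g.
Proof.
move=> e; have [u uE] := gamma_surj (minv f ∘ g).
have : qV (u : pi1 A) = 0 by rewrite -(deg_gamma c X) uE degM degV e addNr.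
rewrite -[RHS](raddf0 (@qV _ _ A)) => /(can_inj (@qVK _ _ A)) u0.
have : gamma X u = idm X by rewrite u0 /gamma tensm1 compm1 compmV.
by rewrite uE => h; rewrite -[RHS](compVKm f) h compm1.
Qed.

Lemma deg_full X Y u : r X = r Y -> exists f : mor X Y, d f = u.
Proof.
move=> /ring_cls_hom[f].
exists (f ∘ gamma X (ps_q (bps_ps A) (u - d f))).
by rewrite degM deg_gamma qK addrC subrK.
Qed.

Definition hom_of X Y (e : r X = r Y) (u : M) : mor X Y :=
  projT1 (cid (deg_full u e)).

Lemma deg_hom_of X Y (e : r X = r Y) u : d (hom_of e u) = u.
Proof. by rewrite /hom_of; case: cid. Qed.

Definition rep_of (x : R) : A := projT1 (cid (ring_cls_surj x)).

Lemma ring_cls_rep_of x : r (rep_of x) = x.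
Proof. by rewrite /rep_of; case: cid. Qed.

Definition rE := (ring_clsD, ring_clsM, ring_cls0, ring_cls1).
Definition degE := (degM, deg1, degV, deg_tensS, deg_tensT, deg_assocS, deg_brS,
  deg_assocT, deg_Ld, deg_Rd, deg_brT, deg_lunitS, deg_runitS, deg_lunitT,
  deg_runitT, deg_Lhat, deg_Rhat, rE).

Ltac obj x X := have [X <-] := ring_cls_surj x.

(** Each of the identities S1 to S12 and S20 to S22 is the degree of one coherence
axiom, in which the potentials cancel. Of the normalizations, those that
express the compatibility of a constraint with a unit are read off in the same
way (triangle, unit axioms of the distributivities, definition of the zero
constraints); the others follow by specializing the identities to 0 and 1. *)
Lemma chart_Z3ab : is_Z3ab k.
Proof.
have s1 x y z t : xi (mac k) y z t - xi (mac k) (x + y) z t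
    + xi (mac k) x (y + z) t - xi (mac k) x y (z + t) + xi (mac k) x y z = 0.
  obj x X; obj y Y; obj z Z; obj t W.
  have := congr1 (@deg _ _ c _ _) (pentagon (S A) X Y Z W).
  by rewrite !degE => E; lin1 E.
have s2 x y z : xi (mac k) x y z - xi (mac k) x z y + xi (mac k) z x y
    + eta (mac k) (x + y) z - eta (mac k) x z - eta (mac k) y z = 0.
  obj x X; obj y Y; obj z Z.
  have := congr1 (@deg _ _ c _ _) (hexagonl (sbr (S A)) X Y Z).
  by rewrite !degE => E; lin1 E.
have s3 x y : eta (mac k) x y + eta (mac k) y x = 0.
  obj x X; obj y Y; have := congr1 (@deg _ _ c _ _) (sbr_sym (S A) X Y).
  by rewrite !degE => E; lin1 E.
have s4 x y z : x *: eta (mac k) y z - eta (mac k) (x * y) (x * z)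
    = lam (mac k) x y z - lam (mac k) x z y.
  obj x X; obj y Y; obj z Z.
  have := congr1 (@deg _ _ c _ _) (ac_br (Ld_functor (ann_distr A) X) Y Z).
  by rewrite /= !degE => E; lin1 E.
have s5 x y z : z *: eta (mac k) x y - eta (mac k) (x * z) (y * z)
    = rho (mac k) x y z - rho (mac k) y x z.
  obj x X; obj y Y; obj z Z.
  have := congr1 (@deg _ _ c _ _) (ac_br (Rd_functor (ann_distr A) Z) X Y).
  by rewrite /= !degE => E; lin1 E.
have s6 x y z t : x *: xi (mac k) y z t - xi (mac k) (x * y) (x * z) (x * t)
    = lam (mac k) x z t - lam (mac k) x (y + z) t + lam (mac k) x y (z + t)
      - lam (mac k) x y z.
  obj x X; obj y Y; obj z Z; obj t W.
  have := congr1 (@deg _ _ c _ _) (ac_assoc (Ld_functor (ann_distr A) X) Y Z W).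
  by rewrite /= !degE => E; lin1 E.
have s7 x y z t : t *: xi (mac k) x y z - xi (mac k) (x * t) (y * t) (z * t)
    = rho (mac k) y z t - rho (mac k) (x + y) z t + rho (mac k) x (y + z) t
      - rho (mac k) x y t.
  obj x X; obj y Y; obj z Z; obj t W.
  have := congr1 (@deg _ _ c _ _) (ac_assoc (Rd_functor (ann_distr A) W) X Y Z).
  by rewrite /= !degE => E; lin1 E.
have s8 x y z t : rho (mac k) x y (z + t) - rho (mac k) x y z - rho (mac k) x y t
    + lam (mac k) x z t + lam (mac k) y z t - lam (mac k) (x + y) z t
    = - xi (mac k) (x * z + x * t) (y * z) (y * t)
      + xi (mac k) (x * z) (x * t) (y * z) - eta (mac k) (x * t) (y * z)
      + xi (mac k) (x * z + y * z) (x * t) (y * t)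
      - xi (mac k) (x * z) (y * z) (x * t).
  (* The interchange contains eta (y * z) (x * t), and S8 - eta (x * t) (y * z). *)
  have := s3 (x * t) (y * z).
  obj x X; obj y Y; obj z Z; obj t W => E3.
  have := congr1 (@deg _ _ c _ _) (LRd_interchange (ann_distr A) X Y Z W).
  by rewrite /interchangem !degE => E; lin (esym E); lin E3; mring.
have s9 x y z t : a x y (z + t) - a x y z - a x y t
    = x *: lam (mac k) y z t + lam (mac k) x (y * z) (y * t)
      - lam (mac k) (x * y) z t.
  obj x X; obj y Y; obj z Z; obj t W.
  have := congr1 (@deg _ _ c _ _) (Ld_assoc (ann_distr A) X Y Z W).
  by rewrite !degE => E; lin1 E.
have s10 x y z t : a x (y + z) t - a x y t - a x z t
    = x *: rho (mac k) y z t - rho (mac k) (x * y) (x * z) t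
      + lam (mac k) x (y * t) (z * t) - t *: lam (mac k) x y z.
  obj x X; obj y Y; obj z Z; obj t W.
  have := congr1 (@deg _ _ c _ _) (LRd_assoc (ann_distr A) X Y Z W).
  by rewrite !degE => E; lin1 E.
have s11 x y z t : a (x + y) z t - a x z t - a y z t
    = - (t *: rho (mac k) x y z) - rho (mac k) (x * z) (y * z) t
      + rho (mac k) x y (z * t).
  obj x X; obj y Y; obj z Z; obj t W.
  have := congr1 (@deg _ _ c _ _) (Rd_assoc (ann_distr A) X Y Z W).
  by rewrite !degE => E; lin1 E.
have s12 x y z t : x *: a y z t - a (x * y) z t + a x (y * z) t - a x y (z * t)
    + t *: a x y z = 0.
  obj x X; obj y Y; obj z Z; obj t W.
  have := congr1 (@deg _ _ c _ _) (pentagon (T A) X Y Z W).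
  by rewrite !degE => E; lin1 E.
have xi0l y z : xi (mac k) 0 y z = 0.
  obj y Y; obj z Z; have := congr1 (@deg _ _ c _ _) (mlunit_tens (S A) Y Z).
  by rewrite !degE => E; lin1 E.
have xi0m y z : xi (mac k) y 0 z = 0.
  obj y Y; obj z Z; have := congr1 (@deg _ _ c _ _) (triangle (S A) Y Z).
  by rewrite !degE => E; lin1 E.
have xi0r y z : xi (mac k) y z 0 = 0.
  by have := s1 y z 0 0; rewrite ?(addr0, xi0m) => E; lin1 E.
have eta0l z : eta (mac k) 0 z = 0.
  have := s2 0 0 z; rewrite ?(addr0, xi0m, xi0l, xi0r) => E.
  by lin1 E.
have eta0r z : eta (mac k) z 0 = 0 by rewrite -(s3 0 z) eta0l add0r.
have lam0m y z : lam (mac k) y 0 z = 0.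
  obj y Y; obj z Z; have := congr1 (@deg _ _ c _ _) (LhatE Y Z).
  by rewrite !degE => E; lin1 E.
have lam0r y z : lam (mac k) y z 0 = 0.
  have := s4 y z 0; rewrite mulr0 !eta0r lam0m => E; lin1 E.
have rho0l y z : rho (mac k) 0 y z = 0.
  obj y Y; obj z Z; have := congr1 (@deg _ _ c _ _) (RhatE Z Y).
  by rewrite !degE => E; lin1 E.
have rho0m y z : rho (mac k) y 0 z = 0.
  have := s5 y 0 z; rewrite mul0r !eta0r rho0l => E; lin1 E.
have lam0l y z : lam (mac k) 0 y z = 0.
  have := s8 0 0 y z.
  by rewrite !(mul0r, rho0l, xi0l, eta0l, addr0) => E; lin1 E.
have rho0r y z : rho (mac k) y z 0 = 0.
  have := s8 y z 0 0.
  rewrite !(mulr0, addr0, lam0m, xi0l, eta0l) => E; lin1 E.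
have a0 y z : [/\ a 0 y z = 0, a y 0 z = 0 & a y z 0 = 0].
  split.
  - have := s11 0 0 y z; rewrite !(mul0r, rho0l, addr0) => E.
    by lin1 E.
  - have := s10 y 0 0 z; rewrite !(mul0r, mulr0, rho0l, lam0m, addr0) => E.
    by lin1 E.
  - have := s9 y z 0 0; rewrite !(mul0r, mulr0, rho0l, lam0m, addr0) => E.
    by lin1 E.
have a1m y z : a y 1 z = 0.
  obj y Y; obj z Z; have := congr1 (@deg _ _ c _ _) (triangle (T A) Y Z).
  by rewrite !degE ?(mulr1, mul1r) => E; lin1 E.
have a1 y z : [/\ a 1 y z = 0, a y 1 z = 0 & a y z 1 = 0].
  split=> //.
    obj y Y; obj z Z; have := congr1 (@deg _ _ c _ _) (mlunit_tens (T A) Y Z).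
    by rewrite !degE ?(mulr1, mul1r) => E; lin1 E.
  by have := s12 y z 1 1; rewrite ?(mulr1, a1m) => E; lin1 E.
have lam1 y z : lam (mac k) 1 y z = 0.
  obj y Y; obj z Z; have := congr1 (@deg _ _ c _ _) (Ld_unit (ann_distr A) Y Z).
  by rewrite !degE ?mul1r => E; lin1 E.
have rho1 y z : rho (mac k) y z 1 = 0.
  obj y Y; obj z Z; have := congr1 (@deg _ _ c _ _) (Rd_unit (ann_distr A) Y Z).
  by rewrite !degE ?mulr1 => E; lin1 E.
split; first by split.
- move=> x y z; obj x X; obj y Y; obj z Z.
  have := congr1 (@deg _ _ c _ _) (hexagonl (brann_br A) X Y Z).
  by rewrite !degE => E; lin1 E.
- move=> x y z; obj x X; obj y Y; obj z Z.
  have := congr1 (@deg _ _ c _ _) (hexagonr (brann_br A) X Y Z).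
  by rewrite !degE => E; lin1 E.
- move=> x y z; obj x X; obj y Y; obj z Z.
  have := congr1 (@deg _ _ c _ _) (@brann_distr A X Y Z).
  by rewrite !degE => E; lin1 E.
Qed.

End ChartTheory.
End Charts.

(** * Cochains that differ by a coboundary *)

Section Cobounding.
Variables (R : comPzRingType) (M : lmodType R).

(** The equation [k - k' = dab mu nu], one component at a time. *)
Record cobounds (mu nu : fun2 M) (k k' : ab_cochain M) : Prop := {
  cobounds_xi : forall x y z, xi (mac k) x y z - xi (mac k') x y z
    = mu y z - mu (x + y) z + mu x (y + z) - mu x y;
  cobounds_eta : forall x y, eta (mac k) x y - eta (mac k') x y
    = mu x y - mu y x;
  cobounds_alpha : forall x y z, alpha (mac k) x y z - alpha (mac k') x y z
    = x *: nu y z - nu (x * y) z + nu x (y * z) - z *: nu x y;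
  cobounds_lam : forall x y z, lam (mac k) x y z - lam (mac k') x y z
    = nu x (y + z) - nu x y - nu x z + x *: mu y z - mu (x * y) (x * z);
  cobounds_rho : forall x y z, rho (mac k) x y z - rho (mac k') x y z
    = nu (x + y) z - nu x z - nu y z + z *: mu x y - mu (x * z) (y * z);
  cobounds_beta : forall x y, beta k x y - beta k' x y = nu x y - nu y x }.

Lemma cobounds_dab mu nu k k' : cobounds mu nu k k' <-> k - k' = dab mu nu.
Proof.
split=> [[h1 h2 h3 h4 h5 h6]|e].
  apply: ab_cochainP => *;
    [exact: h1|exact: h2|exact: h3|exact: h4|exact: h5|exact: h6].
split=> x y.
- by move=> z; have /= := congr1 (fun h : ab_cochain M => xi (mac h) x y z) e.
- by have /= := congr1 (fun h : ab_cochain M => eta (mac h) x y) e.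
- by move=> z; have /= := congr1 (fun h : ab_cochain M => alpha (mac h) x y z) e.
- by move=> z; have /= := congr1 (fun h : ab_cochain M => lam (mac h) x y z) e.
- by move=> z; have /= := congr1 (fun h : ab_cochain M => rho (mac h) x y z) e.
- by have /= := congr1 (fun h : ab_cochain M => beta h x y) e.
Qed.

(** Subtracting from (mu, nu) the coboundary of a function f : R -> M does not change
dab (mu, nu). With f(0) = - mu(0,0) and f(1) = - nu(1,1) the new pair vanishes at
(0,0) and (1,1) respectively, and since k and k' are normalized the other
conditions follow. If 1 = 0 in R, the two prescriptions may clash, but then
M = 0. *)
Lemma cobounds_normalized mu nu k k' : is_Z3ab k -> is_Z3ab k' ->
  cobounds mu nu k k' -> exists mu' nu', normalized2 mu' nu' /\ cobounds mu' nu' k k'.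
Proof.
move=> Zk Zk' [hxi heta ha hl hr hb].
pose f (x : R) : M := if x == 0 then - mu 0 0 else if x == 1 then - nu 1 1 else 0.
pose mu' : fun2 M := fun x y => mu x y + f x + f y - f (x + y).
pose nu' : fun2 M := fun x y => nu x y + x *: f y + y *: f x - f (x * y).
have c' : cobounds mu' nu' k k'.
  split=> x y; rewrite /mu' /nu'.
  - by move=> z; rewrite hxi (addrA x y z); mring.
  - by rewrite heta [y + x]addrC; mring.
  - by move=> z; rewrite ha (mulrA x y z); mring.
  - by move=> z; rewrite hl (mulrDr x y z); mring.
  - by move=> z; rewrite hr (mulrDl x y z); mring.
  - by rewrite hb [y * x]mulrC; mring.
exists mu', nu'; split=> //.
have mu00 : mu' 0 0 = 0.
  by rewrite /mu' addr0 /f eqxx; mring.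
have nu11 : nu' 1 1 = 0.
  rewrite /nu' mulr1 /f; case: (eqVneq (1 : R) 0) => [e|_]; last by rewrite eqxx; mring.
  by rewrite -(scale1r (_ - _)) e scale0r.
case: c' => {}hxi {}heta {}ha {}hl {}hr {}hb.
have mu0l y : mu' 0 y = 0.
  have := hxi 0 0 y.
  have [-> _ _] := xi0 (Z3ab_mac Zk) 0 y; have [-> _ _] := xi0 (Z3ab_mac Zk') 0 y.
  by rewrite !add0r mu00 => E; lin (esym E); mring.
have mu0r y : mu' y 0 = 0.
  have := hxi y 0 0.
  have [_ -> _] := xi0 (Z3ab_mac Zk) y 0; have [_ -> _] := xi0 (Z3ab_mac Zk') y 0.
  by rewrite !addr0 mu00 => E; lin E; mring.
split=> x y; split=> //.
- have := hr 0 0 y.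
  have [_ -> _ _] := rho_norm (Z3ab_mac Zk) 0 0 y.
  have [_ -> _ _] := rho_norm (Z3ab_mac Zk') 0 0 y.
  by rewrite !(mul0r, addr0, mu00) => E; lin E; mring.
- have := hl x 0 0.
  have [_ _ -> _] := lam_norm (Z3ab_mac Zk) x 0 0.
  have [_ _ -> _] := lam_norm (Z3ab_mac Zk') x 0 0.
  by rewrite !(mulr0, addr0, mu00) => E; lin E; mring.
- have := ha 1 1 y.
  have [-> _ _] := alpha1 (Z3ab_mac Zk) 1 y; have [-> _ _] := alpha1 (Z3ab_mac Zk') 1 y.
  by rewrite !mul1r nu11 => E; lin (esym E); mring.
- have := ha x 1 1.
  have [_ -> _] := alpha1 (Z3ab_mac Zk) x 1; have [_ -> _] := alpha1 (Z3ab_mac Zk') x 1.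
  by rewrite !mulr1 nu11 => E; lin E; mring.
Qed.

End Cobounding.

(** * The functor defined by a coboundary *)

Section Morphisms.
Variables (R : comPzRingType) (M : lmodType R).
Variables (A B : brAnnPS M) (k k' : ab_cochain M).
Variables (c : chart A k) (c' : chart B k').
Local Notation r := (ring_cls c).
Local Notation r' := (ring_cls c').
Local Notation d := (deg c).
Local Notation d' := (deg c').

Definition chart_fobj (X : A) : B := rep_of c' (r X).
Local Notation F := chart_fobj.

Lemma chart_fobjE X : r' (F X) = r X. Proof. exact: ring_cls_rep_of. Qed.

Fact chart_fmap_subproof X Y (f : mor X Y) : r' (F X) = r' (F Y).
Proof. by rewrite !chart_fobjE (ring_cls_mor c f). Qed.

Definition chart_fmap X Y (f : mor X Y) : mor (F X) (F Y) :=
  hom_of (chart_fmap_subproof f) (d f).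

Lemma deg_chart_fmap X Y (f : mor X Y) : d' (chart_fmap f) = d f.
Proof. exact: deg_hom_of. Qed.

Fact chart_fmap1 X : chart_fmap (idm X) = idm (F X).
Proof. by apply: (deg_inj (c := c')); rewrite deg_chart_fmap !deg1. Qed.

Fact chart_fmapM X Y Z (g : mor Y Z) (f : mor X Y) :
  chart_fmap (g ∘ f) = chart_fmap g ∘ chart_fmap f.
Proof. by apply: (deg_inj (c := c')); rewrite degM !deg_chart_fmap degM. Qed.

Definition chart_functor : functor A B := Functor chart_fmap1 chart_fmapM.

Variables (mu nu : fun2 M).
Hypothesis munu : cobounds mu nu k k'.
Hypothesis normal : normalized2 mu nu.

Fact chart_fadd_subproof X Y : r' (F X ⊕ F Y) = r' (F (X ⊕ Y)).
Proof. by rewrite ring_clsD !chart_fobjE ring_clsD. Qed.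

(** The degree of an isomorphism from FX ⊕ FY to F(X ⊕ Y) must contain the potentials
of both sums for naturality to hold; what remains is a function of the classes
of X and Y, for which - mu makes the functor compatible with the constraints. *)
Definition chart_fadd X Y : mor (F X ⊕ F Y) (F (X ⊕ Y)) :=
  hom_of (chart_fadd_subproof X Y)
    (pot_add c' (F X) (F Y) - pot_add c X Y - mu (r X) (r Y)).

Fact chart_fmul_subproof X Y : r' (F X ⊗ F Y) = r' (F (X ⊗ Y)).
Proof. by rewrite ring_clsM !chart_fobjE ring_clsM. Qed.

Definition chart_fmul X Y : mor (F X ⊗ F Y) (F (X ⊗ Y)) :=
  hom_of (chart_fmul_subproof X Y)
    (pot_mul c' (F X) (F Y) - pot_mul c X Y - nu (r X) (r Y)).

Fact chart_fone_subproof : r' (munit (T B)) = r' (F (munit (T A))).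
Proof. by rewrite chart_fobjE !ring_cls1. Qed.

Definition chart_fone : mor (munit (T B)) (F (munit (T A))) :=
  hom_of chart_fone_subproof (pot_one c' - pot_one c).

Let fE := (deg_chart_fmap, deg_hom_of, degE, chart_fobjE).

Fact chart_fadd_functor :
  @ac_functor _ _ _ (sbr (S A)) _ (sbr (S B)) chart_functor chart_fadd.
Proof.
split=> [X X' Y Y' f g|X Y Z|X Y]; apply: (deg_inj (c := c')); rewrite /= !fE.
- by rewrite (ring_cls_mor c f) (ring_cls_mor c g); mring.
- by lin (cobounds_xi munu (r X) (r Y) (r Z)); mring.
- by lin (cobounds_eta munu (r X) (r Y)); mring.
Qed.

Fact chart_fmul_functor :
  @ac_functor _ _ _ (brann_br A) _ (brann_br B) chart_functor chart_fmul.
Proof.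
split=> [X X' Y Y' f g|X Y Z|X Y]; apply: (deg_inj (c := c')); rewrite /= !fE.
- by rewrite (ring_cls_mor c f) (ring_cls_mor c g); mring.
- by lin (cobounds_alpha munu (r X) (r Y) (r Z)); mring.
- by lin (cobounds_beta munu (r X) (r Y)); mring.
Qed.

Fact chart_fmul_unit :
  @unit_compat _ _ (T A) (T B) chart_functor chart_fmul chart_fone.
Proof.
split=> X; apply: (deg_inj (c := c')); rewrite /= !fE;
  have [e1 e2] := nu1 normal (r X) (r X); rewrite ?e1 ?e2; mring.
Qed.

Fact chart_fLd X Y Z :
  chart_fmap (Ld (ann_distr A) X Y Z) ∘ chart_fmul X (Y ⊕ Z)
      ∘ (idm (F X) ⊠ chart_fadd Y Z)
    = chart_fadd _ _ ∘ (chart_fmul X Y ⊞ chart_fmul X Z)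
      ∘ Ld (ann_distr B) (F X) (F Y) (F Z).
Proof.
apply: (deg_inj (c := c')); rewrite /= !fE.
by lin (cobounds_lam munu (r X) (r Y) (r Z)); mring.
Qed.

Fact chart_fRd X Y Z :
  chart_fmap (Rd (ann_distr A) X Y Z) ∘ chart_fmul (X ⊕ Y) Z
      ∘ (chart_fadd X Y ⊠ idm (F Z))
    = chart_fadd _ _ ∘ (chart_fmul X Z ⊞ chart_fmul Y Z)
      ∘ Rd (ann_distr B) (F X) (F Y) (F Z).
Proof.
apply: (deg_inj (c := c')); rewrite /= !fE.
by lin (cobounds_rho munu (r X) (r Y) (r Z)); mring.
Qed.

Definition chart_brAnnFunctor : brAnnFunctor A B :=
  @BrAnnFunctor A B chart_functor chart_fadd chart_fmul chart_fone
    chart_fadd_functor chart_fmul_functor chart_fmul_unit chart_fLd chart_fRd.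

Lemma chart_ps_morphism : ps_morphism chart_brAnnFunctor.
Proof.
split=> [s|u].
  rewrite -(repr0K (ps_p _ s)) F0_cls -[LHS](ring_clsE c') chart_fobjE.
  by congr (ps_p _ _); apply: (@p_inj _ _ A); rewrite ring_clsE repr0K.
apply: (can_inj (@qVK _ _ B)); rewrite qK /F1.
rewrite -(deg_gamma c' (F (munit (S A)))) gammaVK /= deg_chart_fmap.
by rewrite -{1}[ps_q _ u]gamma_unit deg_gamma qK.
Qed.

End Morphisms.

(** * The coboundary defined by a functor *)

Section MorphismCobounds.
Variables (R : comPzRingType) (M : lmodType R).
Variables (A B : brAnnPS M) (k k' : ab_cochain M).
Variables (c : chart A k) (c' : chart B k').
Variables (F : brAnnFunctor A B).
Hypothesis psF : ps_morphism F.
Local Notation r := (ring_cls c).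
Local Notation r' := (ring_cls c').
Local Notation d := (deg c).
Local Notation d' := (deg c').
Local Notation O := (munit (S A)).

Lemma ring_cls_fun X : r' (F X) = r X.
Proof.
apply: (@p_inj _ _ B); rewrite ring_clsE -(proj1 psF).
by rewrite ring_clsE F0_cls.
Qed.

Lemma deg_fun_pi1 (u : mor O O) : d' (fmap F u) = d u.
Proof.
rewrite -[in LHS](gammaVK (fmap F u)) deg_gamma.
rewrite -[u in RHS](gamma_unit (A := A)) deg_gamma.
by have := proj2 psF (qV (u : pi1 A)); rewrite qVK /F1 => ->; rewrite qK.
Qed.

(** Every automorphism is gamma_X(u), and F maps it to an automorphism that is
conjugate to F(u) ⊞ id through a structure isomorphism of F and a unit constraint. *)
Lemma deg_fun_aut X (f : mor X X) : d' (fmap F f) = d f.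
Proof.
have [u <-] := gamma_surj f.
have -> : d (gamma X u) = d' (fmap F u).
  by rewrite deg_fun_pi1 deg_gamma -(deg_gamma c O) gamma_unit.
rewrite /gamma !fmapM.
have := congr1 (@deg _ _ _ _ c' _ _) (ac_nat (baf_add_functor F) u (idm X)).
have := congr1 (@deg _ _ _ _ c' _ _) (fmap1 F X).
have := congr1 (@deg _ _ _ _ c' _ _) (fmap1 F (O ⊕ X)).
rewrite -(compVm (mlunit (S A) X)) fmapM !degE => E1 E2 E3.
by lin E1; lin E2; lin (esym E3); mring.
Qed.

Definition to_rep (X : A) : mor X (rep_of c (r X)) :=
  hom_of (esym (ring_cls_rep_of c (r X))) 0.

(** The degree in A and the degree in B of the image under F are additive and agree
on automorphisms, hence they differ by the variation of a function on objects. *)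
Definition shift (X : A) : M :=
  d (to_rep X) - d' (fmap F (to_rep X)).

Lemma deg_fun X Y (f : mor X Y) : d' (fmap F f) = d f + shift Y - shift X.
Proof.
have key Z (g h : mor X Z) : d g - d' (fmap F g) = d h - d' (fmap F h).
  by rewrite -[g](compVKm h) fmapM !(degM c') deg_fun_aut !degM; mring.
have shiftE x (g : mor X (rep_of c x)) : r X = x ->
    d g - d' (fmap F g) = shift X.
  by move=> e; case: x / e in g *; apply: key.
have /shiftE := ring_cls_mor c f; rewrite /shift.
move=> /(_ (to_rep Y ∘ f)); rewrite /shift fmapM !degM => E.
by lin (esym E); mring.
Qed.

(** The opposite of the degree of a structure isomorphism of F, corrected by the
potentials of its source and target so as to become invariant under isomorphisms
of X and Y. *)
Definition jump_add (X Y : A) : M :=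
  pot_add c' (F X) (F Y) - pot_add c X Y - shift X - shift Y + shift (X ⊕ Y)
    - d' (baf_add F X Y).

Definition jump_mul (X Y : A) : M :=
  pot_mul c' (F X) (F Y) - pot_mul c X Y - r X *: shift Y - r Y *: shift X
    + shift (X ⊗ Y) - d' (baf_mul F X Y).

Lemma jump_add_cls X Y X' Y' : r X = r X' -> r Y = r Y' ->
  jump_add X Y = jump_add X' Y'.
Proof.
move=> /(ring_cls_hom (c := c))[f] /(ring_cls_hom (c := c))[g].
have := congr1 (@deg _ _ _ _ c' _ _) (ac_nat (baf_add_functor F) f g).
by rewrite /jump_add !degM !deg_fun !degE !deg_fun => E; lin E; mring.
Qed.

Lemma jump_mul_cls X Y X' Y' : r X = r X' -> r Y = r Y' ->
  jump_mul X Y = jump_mul X' Y'.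
Proof.
move=> eX eY.
have [[f] [g]] := (ring_cls_hom (c := c) eX, ring_cls_hom (c := c) eY).
have := congr1 (@deg _ _ _ _ c' _ _) (ac_nat (baf_mul_functor F) f g).
rewrite /jump_mul !degM !deg_fun !degE !deg_fun !ring_cls_fun -eX -eY => E.
by lin E; mring.
Qed.

Definition mu_fun : fun2 M := fun x y => jump_add (rep_of c x) (rep_of c y).
Definition nu_fun : fun2 M := fun x y => jump_mul (rep_of c x) (rep_of c y).

Lemma deg_baf_add X Y : d' (baf_add F X Y)
  = pot_add c' (F X) (F Y) - pot_add c X Y - shift X - shift Y + shift (X ⊕ Y)
    - mu_fun (r X) (r Y).
Proof.
rewrite /mu_fun (@jump_add_cls _ _ X Y) ?ring_cls_rep_of // /jump_add; mring.
Qed.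

Lemma deg_baf_mul X Y : d' (baf_mul F X Y)
  = pot_mul c' (F X) (F Y) - pot_mul c X Y - r X *: shift Y - r Y *: shift X
    + shift (X ⊗ Y) - nu_fun (r X) (r Y).
Proof.
rewrite /nu_fun (@jump_mul_cls _ _ X Y) ?ring_cls_rep_of // /jump_mul; mring.
Qed.

Ltac obj x X := have [X <-] := ring_cls_surj c x.
Ltac by_fun e := move: (congr1 (@deg _ _ _ _ c' _ _) e);
  rewrite ?(deg_fun, deg_baf_add, deg_baf_mul, degE, ring_cls_fun) => E.

(** The compatibility of F with each constraint is, in degrees, one component of
the coboundary equation. *)
Lemma ps_morphism_cobounds : cobounds mu_fun nu_fun k k'.
Proof.
split.
- move=> x y z; obj x X; obj y Y; obj z Z.
  by by_fun (ac_assoc (baf_add_functor F) X Y Z); lin E; mring.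
- move=> x y; obj x X; obj y Y.
  by by_fun (ac_br (baf_add_functor F) X Y); lin E; mring.
- move=> x y z; obj x X; obj y Y; obj z Z.
  by by_fun (ac_assoc (baf_mul_functor F) X Y Z); lin E; mring.
- move=> x y z; obj x X; obj y Y; obj z Z.
  by by_fun (baf_Ld F X Y Z); lin E; mring.
- move=> x y z; obj x X; obj y Y; obj z Z.
  by by_fun (baf_Rd F X Y Z); lin E; mring.
- move=> x y; obj x X; obj y Y.
  by by_fun (ac_br (baf_mul_functor F) X Y); lin E; mring.
Qed.

End MorphismCobounds.

(** * The category with prescribed cocycle *)

Section Skeleton.
Variables (R : comPzRingType) (M : lmodType R).

(** The objects are the elements of R; the morphisms are the elements of M, and
they exist only between equal objects. *)
Record skel_mor (x y : R) := SkelMor { skel_val : M; skel_eq : x = y }.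

Lemma skel_val_inj x y : injective (@skel_val x y).
Proof.
case=> [u e] [v e'] /= uv; case: v / uv.
by rewrite (Prop_irrelevance e e').
Qed.

Definition skel_id (x : R) := SkelMor 0 (erefl x).
Definition skel_comp (x y z : R) (g : skel_mor y z) (f : skel_mor x y) :=
  SkelMor (skel_val g + skel_val f) (etrans (skel_eq f) (skel_eq g)).
Definition skel_inv (x y : R) (f : skel_mor x y) :=
  SkelMor (- skel_val f) (esym (skel_eq f)).

Definition skel_groupoid : groupoid.
Proof.
refine (@Groupoid R skel_mor skel_id skel_comp skel_inv _ _ _ _ _) => *;
  by apply: skel_val_inj => /=; mring.
Defined.

Local Notation G := skel_groupoid.

Variable (k : ab_cochain M).
Hypothesis Zk : is_Z3ab k.
Let h := mac k.
Let Zh : is_Z3MacL h := Z3ab_mac Zk.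

Let xi0m y z : xi h y 0 z = 0. Proof. by case: (xi0 Zh y z). Qed.
Let al1m y z : alpha h y 1 z = 0. Proof. by case: (alpha1 Zh y z). Qed.

Ltac skel_dest := intros; repeat match goal with f : @mor _ ?x ?y |- _ =>
  change (skel_mor x y) in f; destruct f as [? []] end;
  apply: skel_val_inj => /=.

Definition skel_add : monoidal G.
Proof.
refine (@Monoidal G (fun x y : R => x + y : R)
  (fun x x' y y' (f : skel_mor x x') (g : skel_mor y y') =>
     SkelMor (skel_val f + skel_val g) (congr2 +%R (skel_eq f) (skel_eq g)))
  (0 : R)
  (fun x y z => SkelMor (xi h x y z) (addrA x y z))
  (fun x => SkelMor 0 (add0r x)) (fun x => SkelMor 0 (addr0 x))
  _ _ _ _ _ _ _).
- by move=> *; apply: skel_val_inj => /=; mring.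
- by move=> *; apply: skel_val_inj => /=; mring.
- by skel_dest; mring.
- by move=> *; apply: skel_val_inj => /=; mring.
- by move=> *; apply: skel_val_inj => /=; mring.
- move=> x y z t; apply: skel_val_inj => /=.
  by lin (esym (S1 Zh x y z t)); mring.
- by move=> x y; apply: skel_val_inj; rewrite /= xi0m; mring.
Defined.

Definition skel_mul : monoidal G.
Proof.
refine (@Monoidal G (fun x y : R => x * y : R)
  (fun x x' y y' (f : skel_mor x x') (g : skel_mor y y') =>
     SkelMor (x *: skel_val g + y *: skel_val f)
       (congr2 *%R (skel_eq f) (skel_eq g)))
  (1 : R)
  (fun x y z => SkelMor (alpha h x y z) (mulrA x y z))
  (fun x => SkelMor 0 (mul1r x)) (fun x => SkelMor 0 (mulr1 x))
  _ _ _ _ _ _ _).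
- by move=> *; apply: skel_val_inj => /=; mring.
- by skel_dest; mring.
- by skel_dest; mring.
- by move=> *; apply: skel_val_inj => /=; mring.
- by move=> *; apply: skel_val_inj => /=; mring.
- move=> x y z t; apply: skel_val_inj => /=.
  by lin (esym (S12 Zh x y z t)); mring.
- by move=> x y; apply: skel_val_inj; rewrite /= al1m; mring.
Defined.

Definition skel_add_br : braiding skel_add.
Proof.
refine (@Braiding G skel_add
  (fun x y => SkelMor (eta h x y) (addrC x y)) _ _ _).
- by skel_dest; mring.
- move=> x y z; apply: skel_val_inj => /=.
  (* S2 is one hexagon; the antisymmetry S3 of eta turns it into the other. *)
  lin (S3 Zh x (y + z)); lin (esym (S2 Zh y z x)); lin (esym (S3 Zh x y)).
  by lin (esym (S3 Zh x z)); mring.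
- move=> x y z; apply: skel_val_inj => /=.
  by lin (S2 Zh x y z); mring.
Defined.

Definition skel_sym : symCatGroup G.
Proof.
refine (@SymCatGroup G skel_add skel_add_br _ _).
- move=> x y; apply: skel_val_inj => /=.
  by lin (S3 Zh x y); mring.
- by move=> x; exists (- x); constructor; apply: (SkelMor 0 (subrr x)).
Defined.

Definition skel_mul_br : braiding skel_mul.
Proof.
refine (@Braiding G skel_mul
  (fun x y => SkelMor (beta k x y) (mulrC x y)) _ _ _).
- by skel_dest; mring.
- move=> x y z; apply: skel_val_inj => /=.
  by lin (esym (S21 Zk x y z)); mring.
- move=> x y z; apply: skel_val_inj => /=.
  by lin (S20 Zk x y z); mring.
Defined.

Definition skel_distr : distributivity skel_sym skel_mul.
Proof.
refine (@Distributivity G skel_sym skel_mul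
  (fun x y z => SkelMor (lam h x y z) (mulrDr x y z))
  (fun x y z => SkelMor (rho h x y z) (mulrDl x y z)) _ _ _ _ _ _ _ _ _ _).
- by skel_dest; mring.
- by skel_dest; mring.
- move=> x; split.
  + by skel_dest; mring.
  + move=> y z t; apply: skel_val_inj => /=.
    by lin (S6 Zh x y z t); mring.
  + move=> y z; apply: skel_val_inj => /=.
    by lin (S4 Zh x y z); mring.
- move=> t; split.
  + by skel_dest; mring.
  + move=> x y z; apply: skel_val_inj => /=.
    by lin (S7 Zh x y z t); mring.
  + move=> x y; apply: skel_val_inj => /=.
    by lin (S5 Zh x y t); mring.
- move=> x y z t; apply: skel_val_inj => /=.
  by lin (esym (S9 Zh x y z t)); mring.
- move=> x y z t; apply: skel_val_inj => /=.
  by lin (S11 Zh x y z t); mring.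
- move=> x y z t; apply: skel_val_inj => /=.
  by lin (S10 Zh x y z t); mring.
- move=> x y z t; apply: skel_val_inj => /=.
  lin (esym (S8 Zh x y z t)); lin (S3 Zh (x * t) (y * z)).
  by mring.
- move=> x y; apply: skel_val_inj => /=.
  by have [-> _ _ _] := lam_norm Zh 0 x y; mring.
- move=> x y; apply: skel_val_inj => /=.
  by have [-> _ _ _] := rho_norm Zh x y 0; mring.
Defined.

Definition skel_ann : annCat := AnnCat skel_distr.

Definition skel_brann : brAnnCat.
Proof.
refine (@BrAnnCat skel_ann skel_mul_br _ _).
- apply: skel_val_inj => /=; have := S22 Zk 0 0 0.
  have [_ -> _ _] := lam_norm Zh 0 0 0.
  have [_ -> _ _] := rho_norm Zh 0 0 0.
  by rewrite addr0 => E; lin E; mring.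
- move=> x y z; apply: skel_val_inj => /=.
  by lin (esym (S22 Zk x y z)); mring.
Defined.

Local Notation A := skel_brann.

Definition skel_cls (x : R) : pi0 A := cls (x : A).

Fact skel_cls_zmod : zmod_morphism skel_cls.
Proof.
move=> x y; apply: (addIr (skel_cls y)); rewrite subrK /skel_cls -clsD.
by congr cls; rewrite /= subrK.
Qed.

Fact skel_cls_monoid : monoid_morphism skel_cls.
Proof. by split=> // x y; rewrite /skel_cls -clsM. Qed.

HB.instance Definition _ :=
  GRing.isZmodMorphism.Build R (pi0 A) skel_cls skel_cls_zmod.
HB.instance Definition _ :=
  GRing.isMonoidMorphism.Build R (pi0 A) skel_cls skel_cls_monoid.

Lemma skel_cls_bij : bijective skel_cls.
Proof.
exists (@repr0 A) => [x|s]; last exact: repr0K.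
by have /clsP[[_ e]] := repr0K (skel_cls x).
Qed.

Definition skel_aut (u : M) : pi1 A := SkelMor u (erefl (0 : R)).

Fact skel_aut_zmod : zmod_morphism skel_aut.
Proof. by move=> u v; apply: skel_val_inj. Qed.

HB.instance Definition _ :=
  GRing.isZmodMorphism.Build M (pi1 A) skel_aut skel_aut_zmod.

Lemma skel_aut_bij : bijective skel_aut.
Proof. by exists (@skel_val 0 0) => // f; apply: skel_val_inj. Qed.

Lemma skel_autZ x u : skel_aut (x *: u) = skel_cls x *: skel_aut u.
Proof.
rewrite [RHS](scale1P (x : A) (skel_aut u)).
by case: (Lhat _) => l e; apply: skel_val_inj => /=; mring.
Qed.

Definition skel_ps : preStick M A :=
  @PreStick R M A skel_cls skel_aut skel_cls_bij skel_aut_bij skel_autZ.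

Definition skel : brAnnPS M := BrAnnPS skel_ps.

(** All potentials are zero, since the degree of a morphism is the element of M that
defines it. *)
Definition skel_chart : chart skel k.
Proof.
have qVE (u : pi1 A) : qV (u : pi1 skel) = skel_val (u : skel_mor _ _).
  rewrite -[u in LHS](_ : ps_q skel_ps (skel_val (u : skel_mor _ _)) = u) ?qK //.
  exact: skel_val_inj.
refine (@Chart R M skel k (fun x : R => x) skel_val (fun _ _ => 0) (fun _ _ => 0)
  0 0 _ _ _ _ _ _ _ _ _ _ _ _ _ _ _ _ _) => //.
- by move=> X u; rewrite qVE /=; mring.
1-12: by move=> * /=; mring.
- move=> X; have := congr1 (@skel_val _ _) (LhatE (X : A) (0 : R)).
  move: (Lhat _) => l; rewrite /=.
  by have [_ _ -> _] := lam_norm Zh X 0 0; move=> E; lin E; mring.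
- move=> X; have := congr1 (@skel_val _ _) (RhatE (X : A) (0 : R)).
  move: (Rhat _) => l; rewrite /=.
  by have [_ -> _ _] := rho_norm Zh 0 0 X; move=> E; lin E; mring.
Qed.

End Skeleton.

(** * The chart of a stick *)

Section StickDegree.
Variables (A : brAnnCat) (X : stick A).
Local Notation O := (munit (S A)).
Local Notation I := (munit (T A)).
Implicit Types (r s t : pi0 A) (u v : pi1 A).

Lemma rep_hom s t : mor (X s) (X t) -> s = t.
Proof. by move=> /hom_cls; rewrite !rep_cls. Qed.

(** A morphism between representatives has equal source and target, so it is an
automorphism; [eqm] makes this literal. *)
Definition sdeg s t (f : mor (X s) (X t)) : pi1 A :=
  gammaV (eqm (congr1 X (esym (rep_hom f))) ∘ f).

Lemma sdeg_aut s (f : mor (X s) (X s)) : sdeg f = gammaV f.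
Proof. by rewrite /sdeg eqm_loop comp1m. Qed.

Lemma sdegM r s t (g : mor (X s) (X t)) (f : mor (X r) (X s)) :
  sdeg (g ∘ f) = sdeg g + sdeg f.
Proof.
have e := rep_hom f; have e' := rep_hom g.
case: t / e' g => g; case: s / e f g => f g.
by rewrite !sdeg_aut gammaVM.
Qed.

Lemma sdeg_gamma s u : sdeg (gamma (X s) u) = u.
Proof. by rewrite sdeg_aut gammaK. Qed.

Lemma sdeg1 s : sdeg (idm (X s)) = 0.
Proof. by rewrite -gamma0 sdeg_gamma. Qed.

Lemma sdeg_eqm s t (e : X s = X t) : sdeg (eqm e) = 0.
Proof.
have e' := rep_hom (eqm e); case: t / e' e => e.
by rewrite eqm_loop sdeg1.
Qed.

Lemma sdeg_phi s s' t t' (f : mor (X s) (X s')) (g : mor (X t) (X t')) :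
  sdeg (phi X s' t' ∘ (f ⊞ g) ∘ minv (phi X s t)) = sdeg f + sdeg g.
Proof.
have e := rep_hom f; have e' := rep_hom g.
case: t' / e' g => g; case: s' / e f => f.
rewrite -{1}(gammaVK f) -{1}(gammaVK g) gamma_add -gamma_nat compmK.
by rewrite sdeg_gamma !sdeg_aut.
Qed.

Lemma sdeg_psi s s' t t' (f : mor (X s) (X s')) (g : mor (X t) (X t')) :
  sdeg (psi X s' t' ∘ (f ⊠ g) ∘ minv (psi X s t)) = s *: sdeg g + t *: sdeg f.
Proof.
have e := rep_hom f; have e' := rep_hom g.
case: t' / e' g => g; case: s' / e f => f.
rewrite -{1}(gammaVK f) -{1}(gammaVK g) gamma_mul -gamma_nat compmK.
by rewrite sdeg_gamma !sdeg_aut !rep_cls.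
Qed.

Lemma triv_exists (Y : A) : inhabited (mor Y (X (cls Y))).
Proof. by apply/clsP; rewrite rep_cls. Qed.

Definition triv (Y : A) : mor Y (X (cls Y)) :=
  projT1 (cid (let: inhabits f := triv_exists Y in ex_intro (fun=> True) f Logic.I)).
Local Notation θ := triv.

(** The height of a morphism a from Y to a representative compares it with the chosen
one: it is the degree of a θ^-1. The degree of f : Y -> Z is the height of θ f. *)
Definition ht (Y : A) s (a : mor Y (X s)) : pi1 A := sdeg (a ∘ minv (θ Y)).
Definition mdeg (Y Z : A) (f : mor Y Z) : pi1 A := ht (θ Z ∘ f).

Lemma ht_cls (Y : A) s (a : mor Y (X s)) : cls Y = s.
Proof. by rewrite (hom_cls a) rep_cls. Qed.

Lemma ht_triv (Y : A) : ht (θ Y) = 0.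
Proof. by rewrite /ht compmV sdeg1. Qed.

Lemma ht_post (Y : A) s t (h : mor (X s) (X t)) (a : mor Y (X s)) :
  ht (h ∘ a) = sdeg h + ht a.
Proof. by rewrite /ht -mcompA sdegM. Qed.

Lemma ht_pre (Y Z : A) s (a : mor Z (X s)) (f : mor Y Z) :
  ht (a ∘ f) = ht a + mdeg f.
Proof.
rewrite -{1}(compmVK (θ Z) a) -mcompA ht_post; congr (_ + _).
Qed.

Definition addpot (Y Z : A) : pi1 A := ht (phi X _ _ ∘ (θ Y ⊞ θ Z)).
Definition mulpot (Y Z : A) : pi1 A := ht (psi X _ _ ∘ (θ Y ⊠ θ Z)).
Definition zeropot : pi1 A := ht (minv (eqm (rep0 X))).
Definition onepot : pi1 A := ht (minv (eqm (rep1 X))).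

Lemma ht_phi (Y Z : A) s t (a : mor Y (X s)) (b : mor Z (X t)) :
  ht (phi X s t ∘ (a ⊞ b)) = addpot Y Z + ht a + ht b.
Proof.
rewrite -(compmVK (θ Y) a) -(compmVK (θ Z) b) tensmM mcompA.
rewrite -(compmVK (phi X _ _) (_ ∘ (_ ⊞ _))) -mcompA ht_post sdeg_phi.
by rewrite !compmVK addrC addrA.
Qed.

Lemma ht_psi (Y Z : A) s t (a : mor Y (X s)) (b : mor Z (X t)) :
  ht (psi X s t ∘ (a ⊠ b)) = mulpot Y Z + s *: ht b + t *: ht a.
Proof.
rewrite -(compmVK (θ Y) a) -(compmVK (θ Z) b) tensmM mcompA.
rewrite -(compmVK (psi X _ _) (_ ∘ (_ ⊠ _))) -mcompA ht_post sdeg_psi.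
rewrite !compmVK addrC addrA.
by congr (_ + _ *: _ + _ *: _); [exact: ht_cls a|exact: ht_cls b].
Qed.

Lemma mdegM (Y Z W : A) (g : mor Z W) (f : mor Y Z) :
  mdeg (g ∘ f) = mdeg g + mdeg f.
Proof. by rewrite /mdeg mcompA ht_pre. Qed.

Lemma mdeg_gamma (Y : A) u : mdeg (gamma Y u) = u.
Proof. by rewrite /mdeg -gamma_nat ht_post sdeg_gamma ht_triv addr0. Qed.

Lemma mdeg_add (Y Y' Z Z' : A) (f : mor Y Y') (g : mor Z Z') :
  mdeg (f ⊞ g) = mdeg f + mdeg g + addpot Y Z - addpot Y' Z'.
Proof.
have := ht_pre (phi X _ _ ∘ (θ Y' ⊞ θ Z')) (f ⊞ g).
rewrite -mcompA -tensmM !ht_phi !ht_triv !ht_pre !ht_triv => E.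
by lin (esym E); mring.
Qed.

Lemma mdeg_mul (Y Y' Z Z' : A) (f : mor Y Y') (g : mor Z Z') :
  mdeg (f ⊠ g) = cls Y *: mdeg g + cls Z *: mdeg f + mulpot Y Z - mulpot Y' Z'.
Proof.
have := ht_pre (psi X _ _ ∘ (θ Y' ⊠ θ Z')) (f ⊠ g).
rewrite -mcompA -tensmM !ht_psi !ht_triv !ht_pre !ht_triv.
by rewrite -(hom_cls f) -(hom_cls g) => E; lin (esym E); mring.
Qed.

Lemma mdeg_lunitS (Y : A) : mdeg (mlunit (S A) Y) = addpot O Y + zeropot.
Proof.
have : ht (phi X 0 _ ∘ (minv (eqm (rep0 X)) ⊞ θ Y)) = mdeg (mlunit (S A) Y).
  rewrite -[LHS]add0r -(sdeg_eqm (congr1 X (add0r (cls Y)))) -ht_post.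
  by rewrite mcompA phi0l -mcompA -tensmM compmV comp1m mlunit_nat.
by rewrite ht_phi ht_triv addr0 => <-.
Qed.

Lemma mdeg_runitS (Y : A) : mdeg (mrunit (S A) Y) = addpot Y O + zeropot.
Proof.
have : ht (phi X _ 0 ∘ (θ Y ⊞ minv (eqm (rep0 X)))) = mdeg (mrunit (S A) Y).
  rewrite -[LHS]add0r -(sdeg_eqm (congr1 X (addr0 (cls Y)))) -ht_post.
  by rewrite mcompA phi0r -mcompA -tensmM compmV comp1m mrunit_nat.
by rewrite ht_phi ht_triv addr0 => <-.
Qed.

Lemma mdeg_lunitT (Y : A) : mdeg (mlunit (T A) Y) = mulpot I Y + cls Y *: onepot.
Proof.
have : ht (psi X 1 _ ∘ (minv (eqm (rep1 X)) ⊠ θ Y)) = mdeg (mlunit (T A) Y).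
  rewrite -[LHS]add0r -(sdeg_eqm (congr1 X (mul1r (cls Y)))) -ht_post.
  by rewrite mcompA psi1l -mcompA -tensmM compmV comp1m mlunit_nat.
by rewrite ht_psi ht_triv scaler0 addr0 => <-.
Qed.

Lemma mdeg_runitT (Y : A) : mdeg (mrunit (T A) Y) = mulpot Y I + cls Y *: onepot.
Proof.
have : ht (psi X _ 1 ∘ (θ Y ⊠ minv (eqm (rep1 X)))) = mdeg (mrunit (T A) Y).
  rewrite -[LHS]add0r -(sdeg_eqm (congr1 X (mulr1 (cls Y)))) -ht_post.
  by rewrite mcompA psi1r -mcompA -tensmM compmV comp1m mrunit_nat.
by rewrite ht_psi ht_triv scaler0 addr0 => <-.
Qed.

Lemma mdeg_Lhat (Y : A) :
  mdeg (Lhat Y) = mulpot Y O + cls Y *: zeropot - zeropot.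
Proof.
have E : ht (psi X _ 0 ∘ (θ Y ⊠ minv (eqm (rep0 X)))) = zeropot + mdeg (Lhat Y).
  rewrite /zeropot -ht_pre -[LHS]add0r.
  rewrite -(sdeg_eqm (etrans (etrans (congr1 X (mulr0 (cls Y))) (rep0 X))
    (esym (rep0 X)))) -ht_post -eqmM -eqmV -mcompA (mcompA (eqm _)) psi0r.
  by rewrite -[in RHS](Lhat_nat (θ Y)) -!mcompA -!tensmM compmV comp1m.
by move: E; rewrite ht_psi ht_triv -/zeropot => E; lin (esym E); mring.
Qed.

Lemma mdeg_Rhat (Y : A) :
  mdeg (Rhat Y) = mulpot O Y + cls Y *: zeropot - zeropot.
Proof.
have E : ht (psi X 0 _ ∘ (minv (eqm (rep0 X)) ⊠ θ Y)) = zeropot + mdeg (Rhat Y).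
  rewrite /zeropot -ht_pre -[LHS]add0r.
  rewrite -(sdeg_eqm (etrans (etrans (congr1 X (mul0r (cls Y))) (rep0 X))
    (esym (rep0 X)))) -ht_post -eqmM -eqmV -mcompA (mcompA (eqm _)) psi0l.
  by rewrite -[in RHS](Rhat_nat (θ Y)) -!mcompA -!tensmM compmV comp1m.
by move: E; rewrite ht_psi ht_triv -/zeropot => E; lin (esym E); mring.
Qed.

(** The equation that defines a value u of the induced cochain, precomposed with a:
u is the difference of the heights of the two sides. *)
Lemma ht_induced s t (e : X s = X t) u (Y Z : A) (f : mor Z (X s))
    (b : mor Z (X t)) (a : mor Y Z) :
  eqm e ∘ gamma (X s) u ∘ f = b -> ht (b ∘ a) = u + ht (f ∘ a).
Proof.
move: (gamma _ _) (sdeg_gamma s u) => v vE <-.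
by rewrite -!mcompA !ht_post sdeg_eqm vE add0r.
Qed.

Lemma ht_induced2 s t (e : X s = X t) u (Y Z W : A) (f : mor W (X s))
    (g : mor Z W) (b : mor Z (X t)) (a : mor Y Z) :
  eqm e ∘ gamma (X s) u ∘ f ∘ g = b -> ht (b ∘ a) = u + ht (f ∘ (g ∘ a)).
Proof.
move=> E; rewrite (mcompA f); apply: (@ht_induced _ _ e).
by rewrite mcompA.
Qed.

Variable k : ab_cochain (pi1 A).
Hypothesis ind : induced X k.

Lemma mdeg_assocS (Y Z W : A) : mdeg (massoc (S A) Y Z W)
  = xi (mac k) (cls Y) (cls Z) (cls W)
    + addpot Y (Z ⊕ W) + addpot Z W - addpot (Y ⊕ Z) W - addpot Y Z.
Proof.
have := ht_induced2 (θ Y ⊞ (θ Z ⊞ θ W)) (induced_xi ind (cls Y) (cls Z) (cls W)).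
rewrite -!mcompA massoc_nat !mcompA ht_pre -!(mcompA (phi X _ _)) -!tensmM.
rewrite !comp1m !ht_phi !ht_triv.
by move=> E; lin E; mring.
Qed.

Lemma mdeg_brS (Y Z : A) : mdeg (sbr (S A) Y Z)
  = eta (mac k) (cls Y) (cls Z) + addpot Y Z - addpot Z Y.
Proof.
have := ht_induced (θ Y ⊞ θ Z) (induced_eta ind (cls Y) (cls Z)).
rewrite -!mcompA br_nat mcompA ht_pre !ht_phi !ht_triv.
by move=> E; lin E; mring.
Qed.

Lemma mdeg_assocT (Y Z W : A) : mdeg (massoc (T A) Y Z W)
  = alpha (mac k) (cls Y) (cls Z) (cls W)
    + mulpot Y (Z ⊗ W) + cls Y *: mulpot Z W
    - mulpot (Y ⊗ Z) W - cls W *: mulpot Y Z.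
Proof.
have := ht_induced2 (θ Y ⊠ (θ Z ⊠ θ W)) (induced_alpha ind (cls Y) (cls Z) (cls W)).
rewrite -!mcompA massoc_nat !mcompA ht_pre -!(mcompA (psi X _ _)) -!tensmM.
rewrite !comp1m !ht_psi !ht_triv.
by move=> E; lin E; mring.
Qed.

Lemma mdeg_brT (Y Z : A) : mdeg (brann_br A Y Z)
  = beta k (cls Y) (cls Z) + mulpot Y Z - mulpot Z Y.
Proof.
have := ht_induced (θ Y ⊠ θ Z) (induced_beta ind (cls Y) (cls Z)).
rewrite -!mcompA br_nat mcompA ht_pre !ht_psi !ht_triv.
by move=> E; lin E; mring.
Qed.

Lemma mdeg_Ld (Y Z W : A) : mdeg (Ld (ann_distr A) Y Z W)
  = lam (mac k) (cls Y) (cls Z) (cls W)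
    + mulpot Y (Z ⊕ W) + cls Y *: addpot Z W
    - addpot (Y ⊗ Z) (Y ⊗ W) - mulpot Y Z - mulpot Y W.
Proof.
have := ht_induced2 (θ Y ⊠ (θ Z ⊞ θ W)) (induced_lam ind (cls Y) (cls Z) (cls W)).
rewrite -!mcompA Ld_nat !mcompA ht_pre -!(mcompA (phi X _ _))
  -?(mcompA (psi X _ _)) -!tensmM.
rewrite !comp1m ht_psi !ht_phi !ht_psi !ht_triv.
by move=> E; lin E; mring.
Qed.

Lemma mdeg_Rd (Y Z W : A) : mdeg (Rd (ann_distr A) Y Z W)
  = rho (mac k) (cls Y) (cls Z) (cls W)
    + mulpot (Y ⊕ Z) W + cls W *: addpot Y Z
    - addpot (Y ⊗ W) (Z ⊗ W) - mulpot Y W - mulpot Z W.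
Proof.
have := ht_induced2 ((θ Y ⊞ θ Z) ⊠ θ W) (induced_rho ind (cls Y) (cls Z) (cls W)).
rewrite -!mcompA Rd_nat !mcompA ht_pre -!(mcompA (phi X _ _))
  -?(mcompA (psi X _ _)) -!tensmM.
rewrite !comp1m ht_psi !ht_phi !ht_psi !ht_triv.
by move=> E; lin E; mring.
Qed.

End StickDegree.

Section StickChart.
Variables (R : comPzRingType) (M : lmodType R) (A : brAnnPS M).
Variables (X : stick A) (k : ab_cochain (pi1 A)).
Hypothesis ind : induced X k.
Local Notation p := (ps_p (bps_ps A)).

Definition stick_chart : chart A (transport_cochain p (@qV _ _ A) k).
Proof.
refine (@Chart R M A _ (fun Y => p_inv (cls Y)) (fun Y Z f => qV (mdeg X f))
  (fun Y Z => qV (addpot X Y Z)) (fun Y Z => qV (mulpot X Y Z))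
  (qV (zeropot X)) (qV (onepot X)) _ _ _ _ _ _ _ _ _ _ _ _ _ _ _ _ _).
- by move=> Y; apply: p_invK.
- by move=> *; rewrite mdegM raddfD.
- by move=> *; rewrite mdeg_gamma.
- by move=> *; rewrite mdeg_add !(raddfB, raddfD).
- by move=> *; rewrite mdeg_mul -!qVZ !p_invK !(raddfB, raddfD).
- by move=> *; rewrite (mdeg_assocS ind) !(raddfB, raddfD) /transport_cochain
    /mac /xi /= !p_invK.
- by move=> *; rewrite (mdeg_brS ind) !(raddfB, raddfD) /transport_cochain
    /mac /eta /= !p_invK.
- by move=> *; rewrite (mdeg_assocT ind) -!qVZ !p_invK !(raddfB, raddfD)
    /transport_cochain /mac /alpha /= !p_invK.
- by move=> *; rewrite (mdeg_Ld ind) -!qVZ !p_invK !(raddfB, raddfD)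
    /transport_cochain /mac /lam /= !p_invK.
- by move=> *; rewrite (mdeg_Rd ind) -!qVZ !p_invK !(raddfB, raddfD)
    /transport_cochain /mac /rho /= !p_invK.
- by move=> *; rewrite (mdeg_brT ind) !(raddfB, raddfD) /transport_cochain
    /mac /beta /= !p_invK.
- by move=> *; rewrite mdeg_lunitS raddfD.
- by move=> *; rewrite mdeg_runitS raddfD.
- by move=> *; rewrite mdeg_lunitT -!qVZ !p_invK raddfD.
- by move=> *; rewrite mdeg_runitT -!qVZ !p_invK raddfD.
- by move=> *; rewrite mdeg_Lhat -!qVZ !p_invK !(raddfB, raddfD).
- by move=> *; rewrite mdeg_Rhat -!qVZ !p_invK !(raddfB, raddfD).
Qed.

End StickChart.

(** * Existence of sticks *)

Section StickExistence.
Variable A : brAnnCat.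
Local Notation O := (munit (S A)).
Local Notation I := (munit (T A)).

Hypothesis nontrivial : (1 : pi0 A) != 0.

Lemma unit_neq : I <> O.
Proof. by move=> e; move: nontrivial; rewrite -cls1 e cls0 eqxx. Qed.

Definition rep_choice (s : pi0 A) : A :=
  if s == 0 then O else if s == 1 then I else repr0 s.
Local Notation rep := rep_choice.

Lemma rep_choice_cls s : cls (rep s) = s.
Proof.
rewrite /rep; case: eqP => [->|_]; first exact: cls0.
by case: eqP => [->|_]; [exact: cls1|exact: repr0K].
Qed.

Lemma rep_choice0 : rep 0 = O. Proof. by rewrite /rep eqxx. Qed.
Lemma rep_choice1 : rep 1 = I.
Proof. by rewrite /rep (negPf nontrivial) eqxx. Qed.

(** A function that is prescribed on several overlapping cases exists as soon as the
prescriptions agree. *)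
Lemma glue (U : Type) (P : U -> Prop) : inhabited U ->
  (forall u v, P u -> P v -> u = v) -> exists u, forall v, P v -> u = v.
Proof.
move=> [u0] PP; have [[u Pu]|nP] := pselect (exists u, P u).
  by exists u => v; apply: PP.
by exists u0 => v Pv; case: nP; exists v.
Qed.

(** The values that the axioms of a stick prescribe for phi and psi. The proofs of the
equations between objects are arguments because these equations are not
definitional. *)
Variant add_spec (Y Z W : A) : mor (Y ⊕ Z) W -> Prop :=
  | AddL (e : Y = O) (e' : W = Z) :
      add_spec (minv (eqm e') ∘ (mlunit (S A) Z ∘ (eqm e ⊞ idm Z)))
  | AddR (e : Z = O) (e' : W = Y) :
      add_spec (minv (eqm e') ∘ (mrunit (S A) Y ∘ (idm Y ⊞ eqm e))).

Variant mul_spec (Y Z W : A) : mor (Y ⊗ Z) W -> Prop :=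
  | MulL (e : Y = I) (e' : W = Z) :
      mul_spec (minv (eqm e') ∘ (mlunit (T A) Z ∘ (eqm e ⊠ idm Z)))
  | MulR (e : Z = I) (e' : W = Y) :
      mul_spec (minv (eqm e') ∘ (mrunit (T A) Y ∘ (idm Y ⊠ eqm e)))
  | MulOL (e : Y = O) (e' : W = O) :
      mul_spec (minv (eqm e') ∘ (Rhat Z ∘ (eqm e ⊠ idm Z)))
  | MulOR (e : Z = O) (e' : W = O) :
      mul_spec (minv (eqm e') ∘ (Lhat Y ∘ (idm Y ⊠ eqm e))).

Lemma add_spec_uniq (Y Z W : A) (f g : mor (Y ⊕ Z) W) :
  add_spec f -> add_spec g -> f = g.
Proof.
have lr (U V N : A) (eY : U = O) (eZ : V = O) (e1 : N = V) (e2 : N = U) :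
    minv (eqm e1) ∘ (mlunit (S A) V ∘ (eqm eY ⊞ idm V))
    = minv (eqm e2) ∘ (mrunit (S A) U ∘ (idm U ⊞ eqm eZ)).
  move: (esym eY) => e; case: U / e in eY e2 *.
  move: (esym eZ) => e; case: V / e in eZ e1 *.
  by rewrite (Prop_irrelevance e1 e2) !eqm_loop mlrunit.
case=> e e' [] e2 e2'; rewrite 1?(lr _ _ _ e e2 e' e2') 1?(lr _ _ _ e2 e e2' e') //;
  by rewrite (Prop_irrelevance e e2) (Prop_irrelevance e' e2').
Qed.

(** The overlaps of the four cases: both factors 1, one factor 1 and the other 0,
both factors 0. A factor cannot be 1 and 0 at the same time. *)
Lemma mul_spec_uniq (Y Z W : A) (f g : mor (Y ⊗ Z) W) :
  mul_spec f -> mul_spec g -> f = g.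
Proof.
have lr (U V N : A) (eY : U = I) (eZ : V = I) (e1 : N = V) (e2 : N = U) :
    minv (eqm e1) ∘ (mlunit (T A) V ∘ (eqm eY ⊠ idm V))
    = minv (eqm e2) ∘ (mrunit (T A) U ∘ (idm U ⊠ eqm eZ)).
  move: (esym eY) => e; case: U / e in eY e2 *.
  move: (esym eZ) => e; case: V / e in eZ e1 *.
  by rewrite (Prop_irrelevance e1 e2) !eqm_loop mlrunit.
have lO (U V N : A) (eY : U = I) (eZ : V = O) (e1 : N = V) (e2 : N = O) :
    minv (eqm e1) ∘ (mlunit (T A) V ∘ (eqm eY ⊠ idm V))
    = minv (eqm e2) ∘ (Lhat U ∘ (idm U ⊠ eqm eZ)).
  move: (esym eY) => e; case: U / e in eY *.
  move: (esym eZ) => e; case: V / e in eZ e1 *.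
  by rewrite (Prop_irrelevance e1 e2) !eqm_loop Lhat_one.
have rO (U V N : A) (eY : U = O) (eZ : V = I) (e1 : N = U) (e2 : N = O) :
    minv (eqm e1) ∘ (mrunit (T A) U ∘ (idm U ⊠ eqm eZ))
    = minv (eqm e2) ∘ (Rhat V ∘ (eqm eY ⊠ idm V)).
  move: (esym eY) => e; case: U / e in eY e1 *.
  move: (esym eZ) => e; case: V / e in eZ *.
  by rewrite (Prop_irrelevance e1 e2) !eqm_loop Rhat_one.
have OO (U V N : A) (eY : U = O) (eZ : V = O) (e1 e2 : N = O) :
    minv (eqm e1) ∘ (Rhat V ∘ (eqm eY ⊠ idm V))
    = minv (eqm e2) ∘ (Lhat U ∘ (idm U ⊠ eqm eZ)).
  move: (esym eY) => e; case: U / e in eY *.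
  move: (esym eZ) => e; case: V / e in eZ *.
  by rewrite (Prop_irrelevance e1 e2) !eqm_loop Rhat_zero.
have IO V : V = I -> V = O -> False by move=> -> /unit_neq.
by case=> e e' [] e2 e2';
  solve [ by rewrite (Prop_irrelevance e e2) (Prop_irrelevance e' e2')
        | exact: lr | exact/esym/lr | exact: lO | exact/esym/lO
        | exact: rO | exact/esym/rO | exact: OO | exact/esym/OO
        | by case: (IO _ e e2) | by case: (IO _ e2 e) ].
Qed.

Lemma add_exists s t :
  exists f : mor (rep s ⊕ rep t) (rep (s + t)), forall g, add_spec g -> f = g.
Proof.
apply: glue; last exact: add_spec_uniq.
by apply/clsP; rewrite clsD !rep_choice_cls.
Qed.

Lemma mul_exists s t :
  exists f : mor (rep s ⊗ rep t) (rep (s * t)), forall g, mul_spec g -> f = g.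
Proof.
apply: glue; last exact: mul_spec_uniq.
by apply/clsP; rewrite clsM !rep_choice_cls.
Qed.

Definition stick_choice : stick A.
Proof.
refine (@Stick A rep rep_choice_cls rep_choice0 rep_choice1
  (fun s t => projT1 (cid (add_exists s t)))
  (fun s t => projT1 (cid (mul_exists s t))) _ _ _ _ _ _).
- move=> t; case: cid => f /=.
  by move=> /(_ _ (AddL rep_choice0 (congr1 rep (add0r t)))) ->; rewrite compVKm.
- move=> t; case: cid => f /=.
  by move=> /(_ _ (AddR rep_choice0 (congr1 rep (addr0 t)))) ->; rewrite compVKm.
- move=> t; case: cid => f /=.
  by move=> /(_ _ (MulL rep_choice1 (congr1 rep (mul1r t)))) ->; rewrite compVKm.
- move=> t; case: cid => f /=.
  by move=> /(_ _ (MulR rep_choice1 (congr1 rep (mulr1 t)))) ->; rewrite compVKm.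
- move=> t; case: cid => f /=.
  by move=> /(_ _ (@MulOL _ _ _ rep_choice0
    (etrans (congr1 rep (mul0r t)) rep_choice0))) ->; rewrite compVKm.
- move=> t; case: cid => f /=.
  by move=> /(_ _ (@MulOR _ _ _ rep_choice0
    (etrans (congr1 rep (mulr0 t)) rep_choice0))) ->; rewrite compVKm.
Qed.

End StickExistence.

Section InducedExistence.
Variables (A : brAnnCat) (X : stick A).

(** The element of pi_1 by which the two sides of the equation [eqm e ∘ f ∘ g = b]
differ. *)
Definition defect (Y Z V W : A) (e : V = W) (f : mor Z V) (g : mor Y Z)
    (b : mor Y W) : pi1 A :=
  gammaV (minv (eqm e) ∘ b ∘ minv g ∘ minv f).

Lemma defectE (Y Z V W : A) (e : V = W) (f : mor Z V) (g : mor Y Z)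
    (b : mor Y W) :
  eqm e ∘ gamma V (defect e f g b) ∘ f ∘ g = b.
Proof. by rewrite gammaVK !mcompA compmV comp1m !compmVK. Qed.

Lemma defect1E (Y V W : A) (e : V = W) (f : mor Y V) (b : mor Y W) :
  eqm e ∘ gamma V (defect e f (idm Y) b) ∘ f = b.
Proof. by rewrite -[LHS]compm1 defectE. Qed.

Definition stick_cochain : ab_cochain (pi1 A) :=
  ((fun r s t => defect (congr1 X (addrA r s t))
      (phi X r (s + t)) (idm (X r) ⊞ phi X s t)
      (phi X (r + s) t ∘ (phi X r s ⊞ idm (X t)) ∘ massoc (S A) (X r) (X s) (X t)),
    fun r s => defect (congr1 X (addrC r s)) (phi X r s) (idm _)
      (phi X s r ∘ sbr (S A) (X r) (X s)),
    fun r s t => defect (congr1 X (mulrA r s t))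
      (psi X r (s * t)) (idm (X r) ⊠ psi X s t)
      (psi X (r * s) t ∘ (psi X r s ⊠ idm (X t)) ∘ massoc (T A) (X r) (X s) (X t)),
    fun r s t => defect (congr1 X (mulrDr r s t))
      (psi X r (s + t)) (idm (X r) ⊠ phi X s t)
      (phi X (r * s) (r * t) ∘ (psi X r s ⊞ psi X r t)
        ∘ Ld (ann_distr A) (X r) (X s) (X t)),
    fun r s t => defect (congr1 X (mulrDl r s t))
      (psi X (r + s) t) (phi X r s ⊠ idm (X t))
      (phi X (r * t) (s * t) ∘ (psi X r t ⊞ psi X s t)
        ∘ Rd (ann_distr A) (X r) (X s) (X t))),
   fun r s => defect (congr1 X (mulrC r s)) (psi X r s) (idm _)
      (psi X s r ∘ brann_br A (X r) (X s))).

Lemma stick_cochain_induced : induced X stick_cochain.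
Proof. by split=> *; first [exact: defectE|exact: defect1E]. Qed.

Definition id_preStick : preStick (pi1 A) A :=
  @PreStick _ (pi1 A) A idfun idfun (Bijective (fun=> erefl) (fun=> erefl))
    (Bijective (fun=> erefl) (fun=> erefl)) (fun s u => erefl).

(** A has the identity pre-stick of type (pi_0, pi_1), for which the cochain of the
chart of a stick is the induced cochain itself. *)
Lemma induced_Z3ab k : induced X k -> is_Z3ab k.
Proof.
move=> ind; have /chart_Z3ab := @stick_chart _ _ (BrAnnPS id_preStick) X k ind.
have qVE (u : pi1 A) : @qV _ _ (BrAnnPS id_preStick) u = u.
  exact: (@qK _ _ (BrAnnPS id_preStick)).
by congr is_Z3ab; apply: ab_cochainP => *; apply: qVE.
Qed.

End InducedExistence.

Lemma class_exists (A : brAnnCat) : (1 : pi0 A) != 0 ->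
  exists c : H3ab (pi1 A), is_class c.
Proof.
move=> nt; have ind := stick_cochain_induced (stick_choice nt).
have /asboolP Zk := induced_Z3ab ind.
by exists (H3class (Z3abOf Zk)), (stick_choice nt), (Z3abOf Zk).
Qed.

(** * The classification *)

Section Classification.
Variables (R : comPzRingType) (M : lmodType R).
Implicit Types (A B : brAnnPS M) (k : Z3ab M).

Lemma chart_morphismP A B k k' : chart A k -> chart B k' ->
  BrAnn_class A B <-> H3class k = H3class k'.
Proof.
move=> c c'; split=> [[F psF]|/H3classP[mu [nu [nrm /cobounds_dab munu]]]].
  have [mu [nu [nrm munu]]] := cobounds_normalized (Z3abP k) (Z3abP k')
    (ps_morphism_cobounds c c' psF).
  apply/H3classP; exists mu, nu; split=> //.
  exact/cobounds_dab.
exists (chart_brAnnFunctor c c' munu nrm); exact: chart_ps_morphism.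
Qed.

Lemma lmod_trivial (u v : M) : (1 : R) = 0 -> u = v.
Proof. by move=> e; rewrite -[u]scale1r -[v]scale1r e !scale0r. Qed.

Lemma chart_exists A : exists k, inhabited (chart A k).
Proof.
have [e10|n10] := eqVneq (1 : R) 0.
  exists 0; constructor.
  refine (@Chart R M A _ (fun X => p_inv (cls X : pi0 A)) (fun _ _ _ => 0) (fun _ _ => 0)
    (fun _ _ => 0) 0 0 _ _ _ _ _ _ _ _ _ _ _ _ _ _ _ _ _);
    try by move=> *; apply: lmod_trivial.
  by move=> X; apply: p_invK.
have /class_exists[c [X [k [ind _]]]] : (1 : pi0 A) != 0.
  exact: pi0_nontrivial.
by exists (Z3transport (@qVZ _ _ A) k); constructor; apply: stick_chart ind.
Qed.

Definition chart_cocycle A : Z3ab M := projT1 (cid (chart_exists A)).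

Lemma chart_cocycleP A : inhabited (chart A (chart_cocycle A)).
Proof. by rewrite /chart_cocycle; case: cid. Qed.

Definition chart_class A : H3ab M := H3class (chart_cocycle A).

(** The morphism from A to itself that one chart, used on both sides, provides can be
read with another chart on its source. *)
Lemma chart_classE A k : chart A k -> chart_class A = H3class k.
Proof.
move=> c; have [c'] := chart_cocycleP A.
by apply/(chart_morphismP c' c)/(chart_morphismP c c).
Qed.

Lemma BrAnn_classP A B : BrAnn_class A B <-> chart_class A = chart_class B.
Proof.
have [c] := chart_cocycleP A; have [c'] := chart_cocycleP B.
exact: chart_morphismP.
Qed.

End Classification.

Theorem theorem6p2 (R : comPzRingType) (M : lmodType R) :
  exists Gamma : BrAnn M -> H3ab M,
    [/\ bijective Gamma,
        forall (A : brAnnPS M) (c : H3ab (pi1 A)),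
          is_class c -> Gamma (to_BrAnn A) = ps_transport c
      & (1 : R) != 0 ->
        forall A : brAnnPS M, exists c : H3ab (pi1 A), is_class c].
Proof.
pose rpr (K : BrAnn M) : brAnnPS M := projT1 (cid (svalP K)).
have rprE K : K = to_BrAnn (rpr K).
  by case: K => K KP; apply: eq_exist => /=; rewrite /rpr /=; case: cid.
have GammaE A : chart_class (rpr (to_BrAnn A)) = chart_class A.
  apply/BrAnn_classP; have /(congr1 (fun K : BrAnn M => sval K A)) /= := rprE (to_BrAnn A).
  by move=> <-; apply/BrAnn_classP.
exists (fun K => chart_class (rpr K)); split.
- pose sk (c : H3ab M) : brAnnPS M := skel (Z3abP (repr c)).
  have skE c : chart_class (sk c) = c.
    by rewrite (chart_classE (skel_chart _)); apply: reprK.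
  exists (fun c => to_BrAnn (sk c)) => [K|c]; last by rewrite GammaE skE.
  rewrite [RHS]rprE; apply: eq_exist; apply/funext => B; apply/propext.
  by rewrite !BrAnn_classP skE.
- move=> A _ [X [k [ind ->]]]; rewrite GammaE /ps_transport H3transportE.
  by apply: chart_classE; apply: stick_chart ind.
- move=> n10 A; apply: class_exists; exact: pi0_nontrivial.
Qed.
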